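(* The inclusion map $\Pi\ni\mathcal{P}\mapsto\mathcal{P}\in(\mathcal{F}(\mathcal{X},d_{\mathrm{conc}}),\tau\mathrm{K})$ is a topological embedding, where $\Pi$ carries the weak topology.
   Context: An mm-space is a triple $(X,d_X,\mu_X)$ with $(X,d_X)$ complete separable metric and $\mu_X$ a Borel probability measure; mm-isomorphism means an isometry between supports pushing $\mu_X$ to $\mu_Y$; $\mathcal{X}$ is the set of mm-isomorphism classes. A parameter of $X$ is a Borel map $\varphi\colon I=[0,1)\to X$ with $\varphi_*\mathcal{L}^1=\mu_X$. Box distance: $\square(X,Y)$ is the infimum of $\varepsilon\ge0$ such that there are parameters $\varphi,\psi$ of $X,Y$ and Borel $I_0\subset I$ with $\mathcal{L}^1(I_0)\ge1-\varepsilon$ and $|d_X(\varphi(s),\varphi(t))-d_Y(\psi(s),\psi(t))|\le\varepsilon$ for $s,t\in I_0$. Observable distance: $d_{\mathrm{conc}}(X,Y)=\inf_{\varphi,\psi}d_{\mathrm{H}}(\{f\circ\varphi\},\{g\circ\psi\})$ where $f,g$ range over real 1-Lipschitz functions on $X$, $Y$, and $d_{\mathrm{H}}$ is the Hausdorff distance for the Ky Fan metric $d_{\mathrm{KF}}(u,v)=\inf\{\varepsilon\ge0:\mathcal{L}^1(|u-v|>\varepsilon)\le\varepsilon\}$. Lipschitz order: $Y\prec X$ if there is a 1-Lipschitz $f\colon X\to Y$ with $f_*\mu_X=\mu_Y$. A pyramid is a nonempty $\square$-closed set $\mathcal{P}\subset\mathcal{X}$ such that $X\in\mathcal{P}$,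 $Y\prec X$ imply $Y\in\mathcal{P}$, and any $Y,Y'\in\mathcal{P}$ have a common upper bound $X\in\mathcal{P}$ for $\prec$; every pyramid is $d_{\mathrm{conc}}$-closed. $\Pi$ is the set of pyramids; $\mathcal{P}_n$ converges weakly to $\mathcal{P}$ if $\square(X,\mathcal{P}_n)\to0$ for every $X\in\mathcal{P}$ and $\liminf_n\square(X,\mathcal{P}_n)>0$ for every $X\notin\mathcal{P}$, and the weak topology is the (metrizable) topology of this convergence. For a Hausdorff space $T$, $\mathcal{F}(T)$ is the set of closed subsets; for a net $\{A_\lambda\}$, $\mathrm{Ls}\,A_\lambda$ (resp. $\mathrm{Li}\,A_\lambda$) is the set of points every neighborhood of which meets $A_\lambda$ cofinally (resp. residually); the net Kuratowski–Painlevé converges to $A$ if $\mathrm{Li}\,A_\lambda=\mathrm{Ls}\,A_\lambda=A$; $\tau\mathrm{K}$ is the finest topology on $\mathcal{F}(T)$ in which every Kuratowski–Painlevé convergent net converges to its limit. Here $T=(\mathcal{X},d_{\mathrm{conc}})$. *)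

(* Defs.v *)
From mathcomp Require Import all_boot all_order all_algebra.
From mathcomp Require Import all_classical all_reals all_analysis.
From mathcomp Require Import Rstruct Rstruct_topology.
Import Order.TTheory GRing.Theory Num.Theory.

Set Implicit Arguments.
Unset Strict Implicit.
Unset Printing Implicit Defensive.

Local Open Scope classical_set_scope.
Local Open Scope ring_scope.

Definition RR : realType := Rdefinitions.R.

Definition d_open (T : Type) (d : T -> T -> RR) (A : set T) : Prop :=
  forall x, A x -> exists2 e : RR, 0 < e & [set y | d x y < e] `<=` A.

Definition d_borel (T : Type) (d : T -> T -> RR) : set (set T) :=
  <<s d_open d >>.

(** An mm-space: a complete separable metric space with a Borel
    probability measure (the measure is a function on all subsets of
    which only the values on Borel sets are constrained). *)
Record mmspace : Type := MMSpace {
  mm_car : Type;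
  mm_d : mm_car -> mm_car -> RR;
  mm_d_refl : forall x, mm_d x x = 0;
  mm_d_sep : forall x y, mm_d x y = 0 -> x = y;
  mm_d_sym : forall x y, mm_d x y = mm_d y x;
  mm_d_tri : forall x y z, mm_d x z <= mm_d x y + mm_d y z;
  mm_complete : forall u : nat -> mm_car,
    (forall e : RR, 0 < e -> exists N, forall m n, (N <= m)%N -> (N <= n)%N ->
        mm_d (u m) (u n) < e) ->
    exists x, forall e : RR, 0 < e -> exists N, forall n, (N <= n)%N ->
        mm_d (u n) x < e;
  mm_separable : exists s : nat -> mm_car,
    forall x (e : RR), 0 < e -> exists n, mm_d x (s n) < e;
  mm_mu : set mm_car -> \bar RR;
  mm_mu_ge0 : forall A, d_borel mm_d A -> (0 <= mm_mu A)%E;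
  mm_mu0 : mm_mu set0 = 0%E;
  mm_mu_sigma_additive : forall F : nat -> set mm_car,
    (forall i, d_borel mm_d (F i)) -> trivIset setT F ->
    (fun n => (\sum_(0 <= i < n) mm_mu (F i))%E) @ \oo --> mm_mu (\bigcup_n F n);
  mm_mu_prob : mm_mu setT = 1%E
}.

Definition borel (X : mmspace) : set (set (mm_car X)) := d_borel (@mm_d X).

Definition I01 : set RR := `[0, 1[.
Definition leb : set RR -> \bar RR := @lebesgue_measure RR.

(** parameters: Borel maps phi : I -> X with phi_* L^1 = mu_X
    (phi is given as a map on RR; only its values on I matter) *)
Definition is_parameter (X : mmspace) (phi : RR -> mm_car X) : Prop :=
  (forall B, borel B -> measurable (I01 `&` phi @^-1` B)) /\
  (forall B, borel B -> leb (I01 `&` phi @^-1` B) = mm_mu B).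

Definition box_adm (X Y : mmspace) (e : RR) : Prop :=
  0 <= e /\
  exists (phi : RR -> mm_car X) (psi : RR -> mm_car Y),
    is_parameter phi /\ is_parameter psi /\
    exists I0 : set RR, measurable I0 /\ I0 `<=` I01 /\
      (((1 - e)%R)%:E <= leb I0)%E /\
      forall s t, I0 s -> I0 t ->
        `| mm_d (phi s) (phi t) - mm_d (psi s) (psi t) | <= e.

Definition box (X Y : mmspace) : RR := inf [set e | box_adm X Y e].

Definition box_set (X : mmspace) (P : set mmspace) : RR :=
  inf [set r | exists2 Y, P Y & r = box X Y].

Definition dKF (u v : RR -> RR) : RR :=
  inf [set e : RR | 0 <= e /\
         (leb (I01 `&` [set s | (e < `|u s - v s|)%R]) <= e%:E)%E].

Definition dH_KF (A B : set (RR -> RR)) : RR :=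
  inf [set r : RR | 0 <= r /\
         (forall a, A a -> exists2 b, B b & dKF a b < r) /\
         (forall b, B b -> exists2 a, A a & dKF a b < r)].

Definition lip1 (X : mmspace) : set (mm_car X -> RR) :=
  [set f | forall x y, `| f x - f y | <= mm_d x y].

Definition lip1_param (X : mmspace) (phi : RR -> mm_car X) : set (RR -> RR) :=
  [set u | exists2 f, lip1 f & u = f \o phi].

Definition dconc (X Y : mmspace) : RR :=
  inf [set r | exists (phi : RR -> mm_car X) (psi : RR -> mm_car Y),
         is_parameter phi /\ is_parameter psi /\
         r = dH_KF (lip1_param phi) (lip1_param psi)].

Definition lip_le (Y X : mmspace) : Prop :=
  exists f : mm_car X -> mm_car Y,
    (forall x x', mm_d (f x) (f x') <= mm_d x x') /\
    (forall B, borel B -> mm_mu (f @^-1` B) = mm_mu B).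

Definition box_closed (P : set mmspace) : Prop :=
  forall X, (forall e : RR, 0 < e -> exists2 Y, P Y & box X Y < e) -> P X.

Definition pyramid (P : set mmspace) : Prop :=
  P !=set0 /\ box_closed P /\
  (forall X Y, P X -> lip_le Y X -> P Y) /\
  (forall Y Y', P Y -> P Y' -> exists X, [/\ P X, lip_le Y X & lip_le Y' X]).

Definition weak_cvg (Pn : nat -> set mmspace) (P : set mmspace) : Prop :=
  (forall X, P X -> (fun n => box_set X (Pn n)) @ \oo --> (0 : RR)) /\
  (forall X, ~ P X -> exists2 delta : RR, 0 < delta &
       exists N, forall n, (N <= n)%N -> delta <= box_set X (Pn n)).

(** weak topology on Pi: the topology of weak convergence, i.e. the
    sequential topology it determines (a subset U of Pi is open iff every
    sequence of pyramids weakly converging to a member of U eventually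
    lies in U). *)
Definition weak_open (U : set (set mmspace)) : Prop :=
  U `<=` pyramid /\
  forall P, U P -> forall Pn : nat -> set mmspace,
    (forall n, pyramid (Pn n)) -> weak_cvg Pn P ->
    exists N, forall n, (N <= n)%N -> U (Pn n).

Definition conc_closed (A : set mmspace) : Prop :=
  forall X, (forall e : RR, 0 < e -> exists2 Y, A Y & dconc X Y < e) -> A X.

Definition directed (D : Type) (le : D -> D -> Prop) : Prop :=
  [/\ inhabited D, (forall i, le i i),
      (forall i j k, le i j -> le j k -> le i k) &
      (forall i j, exists k, le i k /\ le j k)].

(** upper / lower closed limits of a net of subsets of (X, dconc);
    neighbourhoods are tested through the open dconc-balls *)
Definition Ls_net (D : Type) (le : D -> D -> Prop) (A : D -> set mmspace)
  : set mmspace :=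
  [set X | forall e : RR, 0 < e -> forall i, exists j, le i j /\
             exists2 Y, A j Y & dconc X Y < e].

Definition Li_net (D : Type) (le : D -> D -> Prop) (A : D -> set mmspace)
  : set mmspace :=
  [set X | forall e : RR, 0 < e -> exists i, forall j, le i j ->
             exists2 Y, A j Y & dconc X Y < e].

Definition KP_cvg (D : Type) (le : D -> D -> Prop) (A : D -> set mmspace)
  (A0 : set mmspace) : Prop :=
  Li_net le A = A0 /\ Ls_net le A = A0.

(** tau_K: the finest topology on F(X) in which every Kuratowski-Painleve
    convergent net converges to its limit: V is open iff every such net
    converging to a member of V eventually lies in V. *)
Definition tauK_open (V : set (set mmspace)) : Prop :=
  V `<=` conc_closed /\
  forall (D : Type) (le : D -> D -> Prop), directed le ->
  forall A : D -> set mmspace, (forall i, conc_closed (A i)) ->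
  forall A0, V A0 -> KP_cvg le A A0 ->
    exists i, forall j, le i j -> V (A j).

(* Main.v *)
(** Everything is read off two comparisons of the box distance with [dconc].
    First [dconc <= box], by McShane extension.  Conversely, if [dconc X Y] is
    small, then finitely many distance functions of [X] are close to 1-Lipschitz
    functions on [Y], and the law of the latter in [R^N] is dominated by [Y] and
    box-close to [X].  Hence for lower-closed families box- and
    [dconc]-approximation agree, so pyramids are [dconc]-closed, weak convergence
    of pyramids is Kuratowski-Painleve convergence for [dconc], and a
    Kuratowski-Painleve convergent net of pyramids satisfies both conditions of
    weak convergence.  As the box distance is separable, a weakly convergent
    sequence can be extracted from any cofinal part of such a net, so the
    complement of [U] in [Pi] is [tau_K]-closed once weak limits of pyramids are
    known to be pyramids.  The only delicate axiom there is the common upper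
    bound: it is a cluster point of couplings on [Y x Y'], obtained from
    Tychonoff's theorem applied to the masses of a refining sequence of cells.

    The technical core is that a probability on the paths of the tree of cells can
    be realised by a map of the unit interval; this yields parameters adapted to a
    given Borel partition, hence the gluing of parameters and the triangle
    inequality for the box distance. *)
Require Import Defs.
From HB Require Import structures.
From mathcomp Require Import all_boot all_order all_algebra.
From mathcomp Require Import all_classical all_reals all_analysis.
From mathcomp Require Import measurable_realfun lra.
Import Order.TTheory GRing.Theory Num.Theory.
Import numFieldNormedType.Exports.

Set Implicit Arguments.
Unset Strict Implicit.
Unset Printing Implicit Defensive.

Local Open Scope classical_set_scope.
Local Open Scope ring_scope.

Local Opaque RR.

(** * Lebesgue measure on the unit interval *)

(** Two mismatches shape the proof. Weak openness is tested by sequences and [tauK_open] by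
    arbitrary nets, which may have uncountable cofinality and no useful subsequence. Separability of
    the box distance helps because it turns both clauses of weak convergence into countably many
    statements of the form: the set meets, or misses, a fixed ball. Each of them holds residually
    along the net, so one diagonal choice of indices serves them all. The other mismatch concerns
    parameters. Two parameters of the same space need not be intertwined by a measure-preserving
    map, so every composition of box estimates reparametrises both sides and pays an arbitrarily
    small error. Such reparametrisations are obtained by sorting the unit interval by labels, which
    asks only for masses of countable Borel partitions and explicit subintervals, with no
    isomorphism theorem for standard Borel spaces. For weak limits a cluster point is enough:
    outside the limit the distance to the pyramids is bounded below eventually, so closeness for
    infinitely many indices already gives membership. *)

Lemma measurable_I01 : measurable I01.
Proof. exact: measurable_itv. Qed.

Lemma leb_I01 : leb I01 = 1%E.
Proof. by rewrite /leb /I01 lebesgue_measure_itv /= lte_fin ltr01 sube0. Qed.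

Lemma I01P t : I01 t <-> 0 <= t < 1.
Proof. by rewrite /I01 set_itvE. Qed.

(** Parameters are unconstrained off [I01], so events enter only through their trace on [I01]. *)
Definition mI (A : set RR) : Prop := measurable (I01 `&` A).

Definition lam (A : set RR) : RR := fine (leb (I01 `&` A)).

Lemma mI_measurable A : measurable A -> mI A.
Proof. by move=> mA; apply: measurableI => //; exact: measurable_I01. Qed.

Lemma eq_I01 (A B : set RR) : (forall t, I01 t -> (A t <-> B t)) ->
  I01 `&` A = I01 `&` B.
Proof. by move=> h; apply/seteqP; split => t [It] /(h t It). Qed.

Lemma eq_mI (A B : set RR) : (forall t, I01 t -> (A t <-> B t)) -> mI A -> mI B.
Proof. by rewrite /mI => /eq_I01 ->. Qed.

Lemma eq_lam (A B : set RR) : (forall t, I01 t -> (A t <-> B t)) ->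
  lam A = lam B.
Proof. by rewrite /lam => /eq_I01 ->. Qed.

Lemma mIT : mI setT.
Proof. exact: mI_measurable. Qed.

Lemma mI0 : mI set0.
Proof. exact: mI_measurable. Qed.

Lemma mIC A : mI A -> mI (~` A).
Proof.
move=> mA; rewrite /mI; have -> : I01 `&` ~` A = I01 `\` (I01 `&` A).
  apply/seteqP; split => t [It nA]; split => //; first by case.
  by move=> At; apply: nA.
by apply: measurableD => //; exact: measurable_I01.
Qed.

Lemma mI_bigcup (F : nat -> set RR) : (forall n, mI (F n)) -> mI (\bigcup_n F n).
Proof.
by move=> mF; rewrite /mI setI_bigcupr; apply: bigcup_measurable => n _; exact: mF.
Qed.

Lemma mIU A B : mI A -> mI B -> mI (A `|` B).
Proof. by move=> mA mB; rewrite /mI setIUr; exact: measurableU. Qed.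

Lemma mII A B : mI A -> mI B -> mI (A `&` B).
Proof.
move=> mA mB; rewrite -(setCK A) -(setCK B) -setCU.
by apply: mIC; apply: mIU; apply: mIC.
Qed.

Lemma mI_bigcup_count (T : countType) (S : set T) (F : T -> set RR) :
  (forall x, S x -> mI (F x)) -> mI (\bigcup_(x in S) F x).
Proof.
move=> mF; rewrite /mI.
have -> : I01 `&` \bigcup_(x in S) F x =
  \bigcup_(x : T) (if `[< S x >] then I01 `&` F x else set0).
  apply/seteqP; split => [t [It [x Sx Ft]]|t [x _]].
    by exists x => //; case: asboolP.
  by case: asboolP => // Sx [It Ft]; split => //; exists x.
apply: countable_bigcupT_measurable; first exact: countableP.
by move=> x; case: asboolP => // /mF.
Qed.

Lemma lamE A : mI A -> leb (I01 `&` A) = (lam A)%:E.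
Proof.
move=> mA; rewrite /lam fineK // ge0_fin_numE; last exact: measure_ge0.
apply: (@le_lt_trans _ _ 1%E); last by rewrite ltry.
rewrite -leb_I01; apply: le_measure; rewrite ?inE //; exact: measurable_I01.
Qed.

Lemma lamT : lam setT = 1.
Proof. by rewrite /lam setIT leb_I01. Qed.

Lemma lam0 : lam set0 = 0.
Proof. by rewrite /lam setI0 /leb measure0. Qed.

Lemma lam_le A B : mI A -> mI B -> (forall t, I01 t -> A t -> B t) ->
  lam A <= lam B.
Proof.
move=> mA mB AB; rewrite -lee_fin -!lamE //; apply: le_measure; rewrite ?inE //.
by move=> t [It At]; split => //; exact: AB.
Qed.

Lemma lam_ge0 A : 0 <= lam A.
Proof. by rewrite /lam fine_ge0 // measure_ge0. Qed.

Lemma lam_le1 A : mI A -> lam A <= 1.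
Proof. by move=> mA; rewrite -lamT; apply: lam_le => //; exact: mIT. Qed.

Lemma lamU A B : mI A -> mI B -> (forall t, I01 t -> A t -> B t -> False) ->
  lam (A `|` B) = lam A + lam B.
Proof.
move=> mA mB AB; apply: EFin_inj; rewrite -lamE; last exact: mIU.
rewrite EFinD -!lamE // setIUr; apply: measureU => //.
by apply/seteqP; split => t // [[It At] [_ Bt]]; exact: (AB t).
Qed.

Lemma lamU_le A B : mI A -> mI B -> lam (A `|` B) <= lam A + lam B.
Proof.
move=> mA mB; rewrite -lee_fin -lamE; last exact: mIU.
by rewrite EFinD -!lamE // setIUr; exact: measureU2.
Qed.

Lemma lamC A : mI A -> lam (~` A) = 1 - lam A.
Proof.
move=> mA; have := @lamU A (~` A) mA (mIC mA) (fun t _ a b => b a).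
by rewrite setUv lamT => ->; rewrite addrAC subrr add0r.
Qed.

Lemma lam_cover_cvg (F : nat -> set RR) : (forall n, mI (F n)) ->
  (forall n m t, (n <= m)%N -> I01 t -> F n t -> F m t) ->
  (forall t, I01 t -> exists n, F n t) ->
  forall e, 0 < e -> exists N, forall n, (N <= n)%N -> 1 - e < lam (F n).
Proof.
move=> mF homo cov e e0.
have bigF : \bigcup_n (I01 `&` F n) = I01.
  apply/seteqP; split => [t [n _ []//]|t It].
  by have [n Fn] := cov t It; exists n.
have : (leb \o (fun n => I01 `&` F n)) n @[n --> \oo] --> leb I01.
  rewrite -[X in leb X]bigF; apply: nondecreasing_cvg_mu => //.
    by rewrite bigF; exact: measurable_I01.
  move=> n m nm; apply/subsetPset => t [It Ft]; split => //; exact: (homo n m).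
rewrite leb_I01 => /fine_cvgP[_] /cvgrPdist_lt /(_ e e0)[N _ hN].
exists N => n Nn; have := hN n Nn; rewrite /= -/(lam (F n)) ltr_norml.
by move=> /andP[_]; lra.
Qed.

(** * Infima of sets of nonnegative reals *)

Lemma inf_nneg_le (S : set RR) x : (forall y, S y -> 0 <= y) -> S x -> inf S <= x.
Proof. by move=> S0 Sx; apply: ge_inf => //; exists 0. Qed.

Lemma inf_nneg_lt (S : set RR) x e : (forall y, S y -> 0 <= y) -> S x ->
  inf S < e -> exists2 y, S y & y < e.
Proof.
move=> S0 Sx Se; have e0 : 0 < e - inf S by rewrite subr_gt0.
have [|y Sy ye] := inf_adherent e0 (E := S).
  by split; [exists x|exists 0].
by exists y => //; rewrite addrC subrK in ye.
Qed.

Lemma inf_nneg_ge0 (S : set RR) : (forall y, S y -> 0 <= y) -> 0 <= inf S.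
Proof.
move=> S0; have [->|/set0P S1] := eqVneq S set0; first by rewrite inf0.
exact: lb_le_inf.
Qed.

(** * Complete separable metric spaces *)

(** An mm-space stripped of its measure: several laws will be put on the same metric space, in
    particular on products. *)
Record cms : Type := CMS {
  ccar : Type;
  cdist : ccar -> ccar -> RR;
  cdist_refl : forall x, cdist x x = 0;
  cdist_sep : forall x y, cdist x y = 0 -> x = y;
  cdist_sym : forall x y, cdist x y = cdist y x;
  cdist_tri : forall x y z, cdist x z <= cdist x y + cdist y z;
  c_complete : forall u : nat -> ccar,
    (forall e : RR, 0 < e -> exists N, forall m n, (N <= m)%N -> (N <= n)%N ->
        cdist (u m) (u n) < e) ->
    exists x, forall e : RR, 0 < e -> exists N, forall n, (N <= n)%N ->
        cdist (u n) x < e;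
  c_separable : exists s : nat -> ccar,
    forall x (e : RR), 0 < e -> exists n, cdist x (s n) < e }.

Arguments cdist : simpl never.

Coercion cms_of (X : mmspace) : cms :=
  CMS (@mm_d_refl X) (@mm_d_sep X) (@mm_d_sym X) (@mm_d_tri X)
      (@mm_complete X) (@mm_separable X).
Canonical cms_of.

Lemma cdist_ge0 (M : cms) (x y : ccar M) : 0 <= cdist x y.
Proof.
have := cdist_tri x y x; rewrite cdist_refl (cdist_sym y x); lra.
Qed.

Lemma cdist_quad (M : cms) (u v u' v' : ccar M) (e : RR) :
  cdist u' u <= e -> cdist v' v <= e -> `|cdist u v - cdist u' v'| <= 2 * e.
Proof.
have := cdist_tri u u' v; have := cdist_tri u' v' v.
have := cdist_tri u' u v'; have := cdist_tri u v v'.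
by rewrite (cdist_sym u u') (cdist_sym v v') ler_norml; lra.
Qed.

Definition cborel (M : cms) : set (set (ccar M)) := d_borel (@cdist M).

Section borel_sets.
Variable M : cms.
Implicit Types A B : set (ccar M).

Lemma cborel_open A : d_open (@cdist M) A -> cborel A.
Proof. exact: sub_sigma_algebra. Qed.

Lemma cborel0 : cborel (set0 : set (ccar M)).
Proof. exact: sigma_algebra0. Qed.

Lemma cborelC A : cborel A -> cborel (~` A).
Proof. by rewrite -setTD; exact: sigma_algebraCD. Qed.

Lemma cborelT : cborel (setT : set (ccar M)).
Proof. by rewrite -setC0; apply: cborelC; exact: cborel0. Qed.

Lemma cborel_bigcup (F : nat -> set (ccar M)) :
  (forall n, cborel (F n)) -> cborel (\bigcup_n F n).
Proof. exact: sigma_algebra_bigcup. Qed.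

Lemma cborelU A B : cborel A -> cborel B -> cborel (A `|` B).
Proof.
move=> bA bB; rewrite -bigcup2E; apply: cborel_bigcup => -[|[|n]] //=.
exact: cborel0.
Qed.

Lemma cborelI A B : cborel A -> cborel B -> cborel (A `&` B).
Proof.
move=> bA bB; rewrite -(setCK A) -(setCK B) -setCU.
by apply: cborelC; apply: cborelU; apply: cborelC.
Qed.

Lemma open_ball x (r : RR) : d_open (@cdist M) [set y | cdist x y < r].
Proof.
move=> y /= xy; exists (r - cdist x y); first by rewrite subr_gt0.
move=> z /= yz; have := cdist_tri x y z; lra.
Qed.

Definition bmeas (phi : RR -> ccar M) : Prop :=
  forall B, cborel B -> mI (phi @^-1` B).

Lemma bmeas_open (phi : RR -> ccar M) :
  (forall U, d_open (@cdist M) U -> mI (phi @^-1` U)) -> bmeas phi.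
Proof.
move=> hU; apply: (@smallest_sub _ _ _ [set B | mI (phi @^-1` B)]) => //.
split => [|A|F] /=.
- by rewrite preimage_set0; exact: mI0.
- by rewrite setTD preimage_setC; exact: mIC.
- by move=> mF; rewrite preimage_bigcup; exact: mI_bigcup.
Qed.

(** By separability an open set is a countable union of balls centred in the dense sequence with
    radii [m.+1%:R^-1], so balls suffice. *)
Lemma bmeas_ball (phi : RR -> ccar M) :
  (forall x r, mI [set t | cdist x (phi t) < r]) -> bmeas phi.
Proof.
move=> hb; apply: bmeas_open => U oU.
have [s hs] := c_separable M.
pose S := [set nm : nat * nat |
  [set y | cdist (s nm.1) y < nm.2.+1%:R^-1] `<=` U].
have : mI (\bigcup_(nm in S) [set t | cdist (s nm.1) (phi t) < nm.2.+1%:R^-1]).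
  by apply: mI_bigcup_count => nm _; exact: hb.
apply: eq_mI => t It; split => [[nm Snm /= h]|Ut]; first exact: Snm.
have [e e0 he] := oU _ Ut.
have [m _ me] := near_infty_natSinv_lt (PosNum (divr_gt0 e0 (ltr0n RR 2))).
have {me}/= me := me m (leqnn m).
have [n hn] := hs (phi t) m.+1%:R^-1 ltac:(by rewrite invr_gt0 ltr0n).
exists (n, m) => /=; last by rewrite cdist_sym.
move=> y /= hy; apply: he => /=; move: me hn hy (cdist_tri (phi t) (s n) y).
by move: (m.+1%:R^-1) => r *; lra.
Qed.

Lemma bmeas_cst (x : ccar M) : bmeas (fun=> x).
Proof.
move=> B _; have [Bx|Bx] := pselect (B x).
  by apply: eq_mI mIT => t _; split.
by apply: eq_mI mI0 => t _; split.
Qed.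

End borel_sets.

(** * 1-Lipschitz maps and image laws *)

Definition clip1 (M M' : cms) (p : ccar M -> ccar M') : Prop :=
  forall x x', cdist (p x) (p x') <= cdist x x'.

Lemma clip1_borel (M M' : cms) (p : ccar M -> ccar M') B :
  clip1 p -> cborel B -> cborel (p @^-1` B).
Proof.
move=> lp; move: B; apply: (@smallest_sub _ _ _ [set B | cborel (p @^-1` B)]).
  split => [|A|F] /=.
- by rewrite preimage_set0; exact: cborel0.
- by rewrite setTD preimage_setC; exact: cborelC.
- by move=> mF; rewrite preimage_bigcup; exact: cborel_bigcup.
move=> U oU; apply: cborel_open => x /= Ux.
have [e e0 he] := oU _ Ux; exists e => // y /= xy; apply: he => /=.
exact: le_lt_trans (lp _ _) xy.
Qed.

Lemma bmeas_clip1 (M M' : cms) (p : ccar M -> ccar M') phi :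
  clip1 p -> bmeas phi -> bmeas (p \o phi).
Proof. by move=> lp mphi B bB; apply: (mphi (p @^-1` B)); exact: clip1_borel. Qed.

Section push.
Variables (M : cms) (phi : RR -> ccar M) (mphi : bmeas phi).

Let pmu (B : set (ccar M)) : \bar RR := leb (I01 `&` phi @^-1` B).

Let pmu_ge0 A : d_borel (@cdist M) A -> (0 <= pmu A)%E.
Proof. by move=> _; exact: measure_ge0. Qed.

Let pmu0 : pmu set0 = 0%E.
Proof. by rewrite /pmu preimage_set0 setI0 /leb measure0. Qed.

Let pmu_sigma (F : nat -> set (ccar M)) :
  (forall i, d_borel (@cdist M) (F i)) -> trivIset setT F ->
  (fun n => (\sum_(0 <= i < n) pmu (F i))%E) @ \oo --> pmu (\bigcup_n F n).
Proof.
move=> bF tF; rewrite /pmu preimage_bigcup setI_bigcupr.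
apply: (@measure_semi_sigma_additive _ _ _ (@lebesgue_measure RR)
  (fun n => I01 `&` phi @^-1` F n)).
- by move=> i; exact: (mphi (bF i)).
- move=> i j _ _ [t [[_ Fi] [_ Fj]]]; apply: (tF i j) => //.
  by exists (phi t).
- by apply: bigcup_measurable => i _; exact: (mphi (bF i)).
Qed.

Let pmu_prob : pmu setT = 1%E.
Proof. by rewrite /pmu preimage_setT setIT leb_I01. Qed.

(** Every auxiliary mm-space is built this way, as the law of a Borel map of the interval; it then
    comes with a parameter. *)
Definition push : mmspace :=
  MMSpace (@cdist_refl M) (@cdist_sep M) (@cdist_sym M) (@cdist_tri M)
    (@c_complete M) (@c_separable M) pmu_ge0 pmu0 pmu_sigma pmu_prob.

Lemma push_parameter : is_parameter (X := push) phi.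
Proof. by split. Qed.

End push.

Lemma parameter_bmeas (X : mmspace) (phi : RR -> mm_car X) :
  is_parameter phi -> @bmeas X phi.
Proof. by case. Qed.

Lemma parameter_lam (X : mmspace) (phi : RR -> mm_car X) B :
  is_parameter phi -> borel B -> mm_mu B = (lam (phi @^-1` B))%:E.
Proof. by move=> [m1 m2] bB; rewrite -lamE ?m2 //; exact: m1. Qed.

Lemma lip_le_push (X : mmspace) (M : cms) (p : mm_car X -> ccar M)
    (xi : RR -> mm_car X) (m : bmeas (p \o xi)) :
  @clip1 X M p -> is_parameter xi -> lip_le (push m) X.
Proof.
move=> lp pxi; exists p; split => // B bB.
by rewrite -(pxi.2 _ (clip1_borel lp bB)).
Qed.

Lemma lip_le_parameter (X Y : mmspace) (p : mm_car X -> mm_car Y)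
    (xi : RR -> mm_car X) :
  (forall x x', mm_d (p x) (p x') <= mm_d x x') ->
  (forall B, borel B -> mm_mu (p @^-1` B) = mm_mu B) ->
  is_parameter xi -> is_parameter (p \o xi).
Proof.
move=> lp mup pxi; split => B bB.
  exact: (@bmeas_clip1 X Y p xi lp (parameter_bmeas pxi)).
rewrite -mup // -(pxi.2 (p @^-1` B)) //.
exact: (@clip1_borel X Y).
Qed.

Lemma exists_natSinv_lt (e : RR) : 0 < e -> exists m : nat, m.+1%:R^-1 < e.
Proof.
move=> e0; have [m _ me] := near_infty_natSinv_lt (PosNum e0).
by exists m; exact: (me m (leqnn m)).
Qed.

(** * The line, the point, products and finite-dimensional spaces *)

Section real_cms.

Let dR (x y : RR) : RR := `|x - y|.

Let dR_refl x : dR x x = 0. Proof. by rewrite /dR subrr normr0. Qed.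

Let dR_sep x y : dR x y = 0 -> x = y.
Proof. by move/eqP; rewrite normr_eq0 subr_eq0 => /eqP. Qed.

Let dR_sym x y : dR x y = dR y x. Proof. exact: distrC. Qed.

Let dR_tri x y z : dR x z <= dR x y + dR y z.
Proof. by apply: le_trans (ler_normD _ _); rewrite addrA subrK. Qed.

Let dR_complete (u : nat -> RR) :
  (forall e : RR, 0 < e -> exists N, forall m n, (N <= m)%N -> (N <= n)%N ->
      dR (u m) (u n) < e) ->
  exists x, forall e : RR, 0 < e -> exists N, forall n, (N <= n)%N ->
      dR (u n) x < e.
Proof.
move=> hu; have cu : cvgn u.
  apply/cauchy_cvgP; apply/cauchy_ballP => e e0.
  have [N hN] := hu e e0.
  exists (u @` [set n | (N <= n)%N], u @` [set n | (N <= n)%N]) => /=.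
    by split; exists N => // n Nn; exists n.
  by move=> [_ _] /= [[m Nm <-] [n Nn <-]]; exact: hN.
exists (limn u) => e e0.
move/cvgrPdist_lt : cu => /(_ e e0)[N _ hN].
by exists N => n /hN; rewrite /dR distrC.
Qed.

Let dR_separable : exists s : nat -> RR,
  forall x (e : RR), 0 < e -> exists n, dR x (s n) < e.
Proof.
exists (fun n => ratr (odflt 0 (unpickle n : option rat))) => x e e0.
have [q] := @rat_in_itvoo RR x (x + e) ltac:(by rewrite ltrDl).
rewrite in_itv /= => /andP[xq qx]; exists (pickle q); rewrite pickleK /= /dR.
by rewrite ltr_norml; lra.
Qed.

Definition Rcms : cms := CMS dR_refl dR_sep dR_sym dR_tri dR_complete dR_separable.

End real_cms.

Section unit_cms.

Let dU (x y : unit) : RR := 0.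

Let dU_sep x y : dU x y = 0 -> x = y. Proof. by case: x; case: y. Qed.

Let dU_tri x y z : dU x z <= dU x y + dU y z. Proof. by rewrite /dU addr0. Qed.

Let dU_complete (u : nat -> unit) :
  (forall e : RR, 0 < e -> exists N, forall m n, (N <= m)%N -> (N <= n)%N ->
      dU (u m) (u n) < e) ->
  exists x, forall e : RR, 0 < e -> exists N, forall n, (N <= n)%N ->
      dU (u n) x < e.
Proof. by move=> _; exists tt => e e0; exists 0%N. Qed.

Let dU_separable : exists s : nat -> unit,
  forall x (e : RR), 0 < e -> exists n, dU x (s n) < e.
Proof. by exists (fun=> tt) => x e e0; exists 0%N. Qed.

Definition unit_cms : cms :=
  @CMS unit dU (fun=> erefl) dU_sep (fun _ _ => erefl) dU_tri dU_complete dU_separable.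

End unit_cms.

Section prod_cms.
Variables M N : cms.
Local Notation T := (ccar M * ccar N)%type.

Let dP (x y : T) : RR := Num.max (cdist x.1 y.1) (cdist x.2 y.2).

Let dP_refl x : dP x x = 0. Proof. by rewrite /dP !cdist_refl maxxx. Qed.

Let dP_sep x y : dP x y = 0 -> x = y.
Proof.
move=> h; have: dP x y <= 0 by rewrite h.
rewrite /dP ge_max => /andP[h1 h2]; case: x y h1 h2 {h} => x1 x2 [y1 y2] /= h1 h2.
by congr pair; apply: cdist_sep; apply/eqP; rewrite eq_le cdist_ge0 andbT.
Qed.

Let dP_sym x y : dP x y = dP y x.
Proof. by rewrite /dP cdist_sym [X in Num.max _ X]cdist_sym. Qed.

Let dP_tri x y z : dP x z <= dP x y + dP y z.
Proof.
rewrite /dP ge_max; apply/andP; split.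
  by apply: le_trans (cdist_tri _ y.1 _) _; apply: lerD; rewrite le_max lexx.
apply: le_trans (cdist_tri _ y.2 _) _.
by apply: lerD; rewrite le_max lexx orbT.
Qed.

Let dP_complete (u : nat -> T) :
  (forall e : RR, 0 < e -> exists N, forall m n, (N <= m)%N -> (N <= n)%N ->
      dP (u m) (u n) < e) ->
  exists x, forall e : RR, 0 < e -> exists N, forall n, (N <= n)%N ->
      dP (u n) x < e.
Proof.
move=> hu.
have [x1 h1] : exists x, forall e : RR, 0 < e -> exists N, forall n, (N <= n)%N ->
    cdist (u n).1 x < e.
  apply: (c_complete (u := fst \o u)) => e /hu[K hK]; exists K => m n Km Kn.
  by have := hK m n Km Kn; rewrite /dP gt_max => /andP[].
have [x2 h2] : exists x, forall e : RR, 0 < e -> exists N, forall n, (N <= n)%N ->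
    cdist (u n).2 x < e.
  apply: (c_complete (u := snd \o u)) => e /hu[K hK]; exists K => m n Km Kn.
  by have := hK m n Km Kn; rewrite /dP gt_max => /andP[].
exists (x1, x2) => e e0; have [K1 hK1] := h1 e e0; have [K2 hK2] := h2 e e0.
exists (maxn K1 K2) => n; rewrite geq_max => /andP[k1 k2].
by rewrite /dP gt_max hK1 // hK2.
Qed.

Let dP_separable : exists s : nat -> T,
  forall x (e : RR), 0 < e -> exists n, dP x (s n) < e.
Proof.
have [s hs] := c_separable M; have [r hr] := c_separable N.
exists (fun n => let nm := odflt (0, 0)%N (unpickle n) in (s nm.1, r nm.2)) => x e e0.
have [n hn] := hs x.1 e e0; have [m hm] := hr x.2 e e0.
by exists (pickle (n, m)); rewrite pickleK /= /dP gt_max hn.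
Qed.

Definition prod_cms : cms := CMS dP_refl dP_sep dP_sym dP_tri dP_complete dP_separable.

Lemma prod_distE (x y : ccar prod_cms) :
  cdist x y = Num.max (cdist x.1 y.1) (cdist x.2 y.2).
Proof. by []. Qed.

Lemma clip1_fst : @clip1 prod_cms M fst.
Proof. by move=> x y; rewrite prod_distE le_max lexx. Qed.

Lemma clip1_snd : @clip1 prod_cms N snd.
Proof. by move=> x y; rewrite prod_distE le_max lexx orbT. Qed.

Lemma clip1_pair (L : cms) (p : ccar L -> ccar M) (q : ccar L -> ccar N) :
  clip1 p -> clip1 q -> @clip1 L prod_cms (fun x => (p x, q x)).
Proof. by move=> lp lq x y; rewrite prod_distE ge_max lp lq. Qed.

Lemma bmeas_pair (a : RR -> ccar M) (b : RR -> ccar N) :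
  bmeas a -> bmeas b -> @bmeas prod_cms (fun t => (a t, b t)).
Proof.
move=> ma mb; apply: bmeas_ball => x r.
have m1 := ma _ (cborel_open (@open_ball _ x.1 r)).
have m2 := mb _ (cborel_open (@open_ball _ x.2 r)).
apply: eq_mI (mII m1 m2) => t _ /=.
by rewrite prod_distE gt_max; split => [[-> ->]//|/andP[]].
Qed.

End prod_cms.

(** This is R^n with the maximum metric, for which a tuple of 1-Lipschitz functions is again
    1-Lipschitz. *)
Fixpoint vec (n : nat) : cms :=
  if n is m.+1 then prod_cms Rcms (vec m) else unit_cms.

Fixpoint mkvec (T : Type) (g : nat -> T -> RR) (n : nat) : T -> ccar (vec n) :=
  if n is m.+1 then fun x => (g m x, mkvec g m x) else fun=> tt.

Lemma mkvec_dist_le (T : Type) (g : nat -> T -> RR) n x y (c : RR) : 0 <= c ->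
  (forall i, (i < n)%N -> `|g i x - g i y| <= c) ->
  cdist (mkvec g n x) (mkvec g n y) <= c.
Proof.
move=> c0; elim: n => //= n IHn h; rewrite prod_distE ge_max /= h //=.
by apply: IHn => i ni; apply: h; exact: ltnW.
Qed.

Lemma le_mkvec_dist (T : Type) (g : nat -> T -> RR) n x y i : (i < n)%N ->
  `|g i x - g i y| <= cdist (mkvec g n x) (mkvec g n y).
Proof.
elim: n => //= n IHn; rewrite ltnS leq_eqVlt prod_distE /=.
rewrite (@le_max _ RR).
by move=> /orP[/eqP->|/IHn ->]; rewrite ?lexx ?orbT.
Qed.

Lemma mkvec_clip1 (M : cms) (g : nat -> ccar M -> RR) n :
  (forall i, @clip1 M Rcms (g i)) -> @clip1 M (vec n) (mkvec g n).
Proof. by move=> lg x y; apply: mkvec_dist_le => [|i _]; [exact: cdist_ge0|exact: lg]. Qed.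

Lemma Rborel_measurable (A : set RR) : @cborel Rcms A -> measurable A.
Proof.
move: A; apply: (@smallest_sub _ _ _ measurable).
  exact: sigma_algebra_measurable.
move=> U oU; apply: open_measurable; rewrite openE => x Ux.
have [e e0 he] := oU x Ux; apply/nbhs_ballP; exists e => // y xy; exact: he.
Qed.

Lemma measurable_Rborel (A : set RR) : measurable A -> @cborel Rcms A.
Proof.
move=> mA.
have {mA} : (@RGenOpens.G RR).-sigma.-measurable A by rewrite -RGenOpens.measurableE.
move: A; apply: (@smallest_sub _ _ _ (@cborel Rcms)).
  exact: smallest_sigma_algebra.
move=> _ [a [b ->]]; apply: cborel_open; set U := (X in d_open _ X) => x Ux.
have oU : open U by exact: interval_open.
have /nbhs_ballP[e e0 he] : nbhs x U by exact: open_nbhs_nbhs (conj oU Ux).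
by exists e => // y xy; exact: he.
Qed.

Lemma bmeas_id : @bmeas Rcms id.
Proof. by move=> B /Rborel_measurable; exact: mI_measurable. Qed.

(** Its parameters are, up to a null set, the measure-preserving self-maps of the interval, so
    results on parameters yield reparametrisations. *)
Definition Ispace : mmspace := push bmeas_id.

Lemma mI_dist_gt (u v : RR -> RR) (e : RR) : @bmeas Rcms u -> @bmeas Rcms v ->
  mI [set s | e < `|u s - v s|].
Proof.
move=> mu mv; apply: (bmeas_pair mu mv (B := [set x | e < `|x.1 - x.2|])).
apply: cborel_open => -[x y] /= exy.
exists ((`|x - y| - e) / 2); first by rewrite divr_gt0 ?subr_gt0.
move=> -[x' y'] /=; rewrite prod_distE gt_max /= => /andP[h1 h2].
rewrite /cdist /= in h1 h2.
have := ler_normB (x - x') (y - y').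
have := ler_normD (x' - y') (x - y - (x' - y')).
have -> : x' - y' + (x - y - (x' - y')) = x - y by lra.
have -> : x - y - (x' - y') = (x - x') - (y - y') by lra.
by lra.
Qed.

(** * Realising tree masses on the unit interval *)

Lemma lam_itvco (a b : RR) : 0 <= a -> a <= b -> b <= 1 ->
  mI (`[a, b[%classic : set RR) /\ lam (`[a, b[%classic : set RR) = b - a.
Proof.
move=> a0 ab b1; split; first by apply: mI_measurable; exact: measurable_itv.
rewrite /lam setIidr; last first.
  by move=> t /=; rewrite in_itv /= => /andP[h1 h2]; apply/I01P; lra.
rewrite /leb lebesgue_measure_itv /= lte_fin; case: ifP => //.
move/negbT; rewrite -leNgt => ba; have -> : b - a = 0 by lra.
exact: fine0.
Qed.

(** A probability on the paths of the tree of finite words, given by the masses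
    [p w] of the cylinders, is realised on the unit interval by letting the
    children of a node subdivide its interval from left to right.  Words are
    read backwards: the head is the last letter. *)
Record tree_mass (p : seq nat -> RR) : Prop := TreeMass {
  tree_ge0 : forall w, 0 <= p w;
  tree_root : p [::] = 1;
  tree_sum_le : forall w n, \sum_(0 <= c < n) p (c :: w) <= p w;
  tree_sum_cvg : forall w (e : RR), 0 < e ->
    exists n, p w - e < \sum_(0 <= c < n) p (c :: w) }.

Section tree.
Variable p : seq nat -> RR.
Hypothesis tp : tree_mass p.

Let S w n := \sum_(0 <= c < n) p (c :: w).

Let SS w n : S w n.+1 = S w n + p (n :: w).
Proof. by rewrite /S big_nat_recr. Qed.

Let S_mono w : {homo S w : m n / (m <= n)%N >-> m <= n}.
Proof.
apply: homo_leq => [//|? ? ?|n]; first exact: le_trans.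
by rewrite SS lerDl tree_ge0.
Qed.

Fixpoint tree_left (w : seq nat) : RR :=
  if w is c :: w' then tree_left w' + \sum_(0 <= i < c) p (i :: w') else 0.

Definition tree_itv w (t : RR) := tree_left w <= t < tree_left w + p w.

Let itv_cons c w t : tree_itv (c :: w) t -> tree_itv w t.
Proof.
rewrite /tree_itv /= -/(S w c) => /andP[h1 h2].
have : 0 <= S w c by rewrite -[X in X <= _](_ : S w 0 = 0) ?S_mono // /S big_geq.
have := tree_sum_le tp w c.+1; rewrite -/(S _ _) SS; lra.
Qed.

(** The children exhaust the mass of [w], and half-open intervals miss no endpoint: the first child
    whose right end exceeds [t] contains [t]. Hence no null set has to be removed. *)
Let itv_child w t : tree_itv w t -> exists c, tree_itv (c :: w) t.
Proof.
rewrite /tree_itv => /andP[h1 h2].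
have e0 : 0 < tree_left w + p w - t by lra.
have [n hn] := tree_sum_cvg tp w e0; rewrite -/(S w n) in hn.
have ex : exists n, t - tree_left w < S w n by exists n; lra.
case: (ex_minnP ex) => -[|c] hc hmin.
  by move: hc; rewrite /S big_geq //; lra.
exists c; rewrite /= -/(S w c); rewrite SS in hc.
have : ~~ (t - tree_left w < S w c) by apply/negP => /hmin; rewrite ltnn.
by rewrite -leNgt; lra.
Qed.

Let itv_uniq c c' w t : tree_itv (c :: w) t -> tree_itv (c' :: w) t -> c = c'.
Proof.
rewrite /tree_itv /= -!/(S w _) => /andP[h1 h2] /andP[h3 h4].
case: (ltngtP c c') => // cc'; exfalso; have := S_mono w cc'; rewrite SS; lra.
Qed.

(** The address of [t] at depth [k]; the default letter 0 is reached only off [I01]. *)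
Fixpoint tree_word (k : nat) (t : RR) : seq nat :=
  if k is k'.+1 then
    xget 0%N [set c | tree_itv (c :: tree_word k' t) t] :: tree_word k' t
  else [::].

Lemma size_tree_word k t : size (tree_word k t) = k.
Proof. by elim: k => //= k ->. Qed.

Let itv_word k t : I01 t -> tree_itv (tree_word k t) t.
Proof.
move=> /I01P It; elim: k => [|k IHk]; first by rewrite /tree_itv /= tree_root //; lra.
have [c hc] := itv_child IHk.
exact: (@xgetPex _ 0%N [set c | tree_itv (c :: tree_word k t) t] (ex_intro _ c hc)).
Qed.

Lemma tree_wordP w t : I01 t -> tree_itv w t <-> tree_word (size w) t = w.
Proof.
move=> It; split => [|<-]; last exact: itv_word.
elim: w => //= c w IHw hc; have hw := IHw (itv_cons hc).
rewrite hw; congr cons; apply: (@itv_uniq _ _ w t) => //.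
exact: (@xgetPex _ 0%N [set c | tree_itv (c :: w) t] (ex_intro _ c hc)).
Qed.

Let itv_bounds w : 0 <= tree_left w /\ tree_left w + p w <= 1.
Proof.
elim: w => /= [|c w [h1 h2]]; first by rewrite tree_root //; lra.
rewrite -/(S w c).
have : 0 <= S w c by rewrite -[X in X <= _](_ : S w 0 = 0) ?S_mono // /S big_geq.
have := tree_sum_le tp w c.+1; rewrite -/(S _ _) SS; lra.
Qed.

Lemma lam_tree_word w : mI [set t | tree_word (size w) t = w] /\
  lam [set t | tree_word (size w) t = w] = p w.
Proof.
have [h1 h2] := itv_bounds w; have h3 := tree_ge0 tp w.
have [m1 m2] := @lam_itvco (tree_left w) (tree_left w + p w) h1 ltac:(lra) h2.
have E t : I01 t -> (`[tree_left w, tree_left w + p w[%classic : set RR) t <->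
    [set t | tree_word (size w) t = w] t.
  by move=> It; rewrite /= in_itv -tree_wordP.
split; first exact: eq_mI m1.
by rewrite -(eq_lam E) m2 addrAC subrr add0r.
Qed.

(** A half-open interval containing a point has positive length, so only addresses of positive mass
    occur, and their cells will be inhabited. *)
Lemma tree_word_gt0 k t : I01 t -> 0 < p (tree_word k t).
Proof. by move=> /(itv_word k); rewrite /tree_itv; lra. Qed.

End tree.

(** * Cells of a sequence of labellings *)

Section labels.
Variables (M : cms) (L : nat -> ccar M -> nat).

Fixpoint label_word (k : nat) (x : ccar M) : seq nat :=
  if k is k'.+1 then L k' x :: label_word k' x else [::].

Lemma size_label_word k x : size (label_word k x) = k.
Proof. by elim: k => //= k ->. Qed.

Definition cell (w : seq nat) : set (ccar M) :=
  [set x | label_word (size w) x = w].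

Lemma cell_cons c w : cell (c :: w) = cell w `&` [set x | L (size w) x = c].
Proof. by apply/seteqP; split => x; rewrite /cell /= => -[-> ->]. Qed.

Hypothesis bL : forall k c, cborel [set x | L k x = c].

Lemma cborel_cell w : cborel (cell w).
Proof.
elim: w => [|c w IHw]; last by rewrite cell_cons; exact: cborelI.
by rewrite (_ : cell _ = setT); [exact: cborelT|exact/seteqP].
Qed.

End labels.

Section tree_limit.
Variables (M : cms) (L : nat -> ccar M -> nat) (p : seq nat -> RR).
Hypothesis tp : tree_mass p.
(* No smallness is required at level 0, so that the first letter can carry an
   arbitrary prescribed label. *)
Hypothesis Lsmall : forall k x y, L k.+1 x = L k.+1 y -> cdist x y <= k.+1%:R^-1.
Hypothesis pcell : forall w, 0 < p w -> cell L w !=set0.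

Lemma label_word_le k k' x t : (k <= k')%N ->
  label_word L k' x = tree_word p k' t -> label_word L k x = tree_word p k t.
Proof.
move=> /subnK <-; by elim: (k' - k)%N => //= n IHn [_ /IHn].
Qed.

(** Points chosen in the cells along the address of [t] form a Cauchy sequence, and [phi t] is its
    limit. A word of length [k.+2] records the label of level [k.+1], which by [Lsmall] fixes a
    point up to [k.+1%:R^-1]; this closed bound survives in the limit. *)
Lemma tree_limit : exists phi : RR -> ccar M, bmeas phi /\
  forall t k y, I01 t -> label_word L k.+2 y = tree_word p k.+2 t ->
    cdist y (phi t) <= k.+1%:R^-1.
Proof.
have p1 : exists x, cell L [::] x by apply: pcell; rewrite tree_root.
have [x0 _] := p1.
have [pt hpt] : {pt : seq nat -> ccar M & forall w, 0 < p w -> cell L w (pt w)}.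
  apply: (choice (P := fun w x => 0 < p w -> cell L w x)) => w.
  have [/pcell[x hx]|] := pselect (0 < p w); first by exists x.
  by exists x0.
have ptP k t : I01 t -> label_word L k (pt (tree_word p k t)) = tree_word p k t.
  by move=> /(tree_word_gt0 tp k)/hpt; rewrite /cell /= size_tree_word.
have near k k' y t : I01 t -> (k.+2 <= k')%N ->
    label_word L k.+2 y = tree_word p k.+2 t ->
    cdist y (pt (tree_word p k' t)) <= k.+1%:R^-1.
  move=> It kk' hy; apply: Lsmall.
  have := label_word_le kk' (ptP k' t It).
  by rewrite -hy /= => -[].
have lim t : exists x, I01 t -> forall k y,
    label_word L k.+2 y = tree_word p k.+2 t -> cdist y x <= k.+1%:R^-1.
  have [It|nIt] := pselect (I01 t); last by exists x0.
  have [e e0|x hx] := @c_complete M (fun k => pt (tree_word p k t)).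
    have [k ke] := exists_natSinv_lt e0; exists k.+2 => m n km kn.
    apply: le_lt_trans ke; apply: Lsmall.
    have := label_word_le kn (ptP n t It).
    by rewrite -(label_word_le km (ptP m t It)) /= => -[].
  exists x => _ k y hy; apply/ler_addgt0Pr => e e0.
  have [N hN] := hx e e0; pose n := maxn N k.+2.
  have h1 := near k n y t It (leq_maxr _ _) hy.
  have h2 := hN n (leq_maxl _ _).
  by apply: le_trans (cdist_tri _ (pt (tree_word p n t)) _) _; apply: lerD => //; exact: ltW.
have [phi hphi] := choice lim.
exists phi; split; last by move=> t k y It; exact: hphi.
apply: bmeas_ball => x r.
(* The limit is within [r] of [x] exactly when some finite address certifies it, which makes the
   event a countable union of intervals. *)
pose W := [set w : seq nat | exists2 k, size w = k.+2 & cdist x (pt w) + k.+1%:R^-1 < r].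
have : mI (\bigcup_(w in W) [set t | tree_word p (size w) t = w]).
  by apply: mI_bigcup_count => w _; have [] := lam_tree_word tp w.
apply: eq_mI => t It; split => [[w [k sw hw] /= wt]|/= xr].
  rewrite sw in wt; apply: le_lt_trans hw.
  apply: le_trans (cdist_tri _ (pt w) _) _; rewrite lerD2l.
  by apply: hphi => //; rewrite -wt; exact: ptP.
have r0 : 0 < (r - cdist x (phi t)) / 2 by rewrite divr_gt0 // subr_gt0.
have [k hk] := exists_natSinv_lt r0.
exists (tree_word p k.+2 t); last by rewrite /= size_tree_word.
exists k; first by rewrite size_tree_word.
have := hphi t It k (pt (tree_word p k.+2 t)) (ptP _ _ It).
rewrite cdist_sym; move: hk (cdist_tri x (phi t) (pt (tree_word p k.+2 t))).
by move: (k.+1%:R^-1) => s *; lra.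
Qed.

End tree_limit.

(** The label is the index of the first ball about the dense sequence that contains the point, so
    its fibres are Borel. *)
Lemma exists_label (M : cms) (e : RR) : 0 < e ->
  exists l : ccar M -> nat, (forall c, cborel [set x | l x = c]) /\
    exists s : nat -> ccar M, forall x, cdist (s (l x)) x < e.
Proof.
move=> e0; have [s hs] := c_separable M.
have ex x : exists n, cdist (s n) x < e.
  by have [n] := hs x e e0; rewrite cdist_sym => ?; exists n.
exists (fun x => ex_minn (ex x)); split; last first.
  by exists s => x; case: ex_minnP.
move=> c.
have -> : [set x | ex_minn (ex x) = c] = [set x | cdist (s c) x < e] `&`
    ~` \bigcup_n (if (n < c)%N then [set x | cdist (s n) x < e] else set0).
  apply/seteqP; split => x /=.
    move=> <-; case: ex_minnP => n hn hmin; split => // -[m _].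
    by case: ifP => // mn /= /hmin; rewrite leqNgt mn.
  move=> [hc hn]; case: ex_minnP => n hn' hmin; apply/eqP; rewrite eqn_leq hmin //=.
  rewrite leqNgt; apply/negP => nc; apply: hn; exists n => //; rewrite nc //.
apply: cborelI; first exact: cborel_open (@open_ball _ _ _).
apply: cborelC; apply: cborel_bigcup => n; case: ifP => _; last exact: cborel0.
exact: cborel_open (@open_ball _ _ _).
Qed.

Lemma exists_labels (M : cms) : exists L : nat -> ccar M -> nat,
  (forall k c, cborel [set x | L k x = c]) /\
  (forall k x y, L k x = L k y -> cdist x y <= k.+1%:R^-1).
Proof.
have ex k : exists l : ccar M -> nat, (forall c, cborel [set x | l x = c]) /\
    (forall x y, l x = l y -> cdist x y <= k.+1%:R^-1).
  have e0 : 0 < k.+1%:R^-1 / 2 :> RR by rewrite divr_gt0 ?invr_gt0 ?ltr0n.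
  have [l [bl [s hs]]] := exists_label M e0; exists l; split => // x y xy.
  have := hs x; have := hs y; rewrite xy; have := cdist_tri x (s (l y)) y.
  rewrite (cdist_sym x (s (l y))); move: (k.+1%:R^-1) => r *; lra.
have [L hL] := choice ex.
by exists L; split => [k|k]; have [] := hL k.
Qed.

(** * Adapted parameters *)

Lemma mm_inhabited (X : mmspace) : exists x : mm_car X, True.
Proof.
apply: contrapT => h; have := mm_mu_prob X.
rewrite (_ : setT = set0) ?mm_mu0; first by move=> /eqP; rewrite eq_sym onee_eq0.
by apply/seteqP; split => x // _; apply: h; exists x.
Qed.

(** An alias of the carrier on which the Borel sets are declared as the canonical measurable
    structure. *)
Definition bcar (X : mmspace) : Type := mm_car X.

HB.instance Definition _ X := gen_eqMixin (bcar X).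
HB.instance Definition _ X := gen_choiceMixin (bcar X).
HB.instance Definition _ X :=
  isPointed.Build (bcar X) (sval (cid (mm_inhabited X))).
HB.instance Definition _ X := @isMeasurable.Build default_measure_display (bcar X)
  (@borel X) (@cborel0 X) (@cborelC X) (@cborel_bigcup X).

(* [mm_mu] is unconstrained, possibly negative, on non-Borel sets. *)
Definition mmu (X : mmspace) (A : set (bcar X)) : \bar RR := maxe (mm_mu A) 0%E.

Lemma mmuE (X : mmspace) (A : set (bcar X)) : borel A -> mmu A = mm_mu A.
Proof. by move=> bA; rewrite /mmu max_l // mm_mu_ge0. Qed.

Section mmu_measure.
Variable X : mmspace.

Let mmu0 : @mmu X set0 = 0%E.
Proof. by rewrite mmuE ?mm_mu0 //; exact: (@cborel0 X). Qed.

Let mmu_ge0 A : (0 <= @mmu X A)%E.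
Proof. by rewrite /mmu le_max lexx orbT. Qed.

Let mmu_sigma : semi_sigma_additive (@mmu X).
Proof.
move=> F mF tF mUF; rewrite mmuE //.
rewrite (_ : (fun _ => _) = (fun n => \sum_(0 <= i < n) mm_mu (F i))%E).
  exact: mm_mu_sigma_additive.
by apply/funext => n; apply: eq_bigr => i _; rewrite mmuE //; exact: mF.
Qed.

HB.instance Definition _ := isMeasure.Build _ _ _ (@mmu X) mmu0 mmu_ge0 mmu_sigma.

End mmu_measure.

Section image_measure.
Variables (X : mmspace) (phi : RR -> mm_car X) (J : set RR).
Hypotheses (mphi : @bmeas X phi) (mJ : mI J).

(** The law of [phi] restricted to the event [J]. The two proofs are arguments because the measure
    structure depends on them. *)
Definition image_measure of @bmeas X phi & mI J :=
  fun B : set (bcar X) => leb (I01 `&` (J `&` phi @^-1` B)).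

Local Notation nu := (image_measure mphi mJ).

Let nu0 : nu set0 = 0%E.
Proof. by rewrite /image_measure preimage_set0 !setI0 /leb measure0. Qed.

Let nu_ge0 A : (0 <= nu A)%E. Proof. exact: measure_ge0. Qed.

Let nu_sigma : semi_sigma_additive nu.
Proof.
move=> F mF tF mUF; rewrite /image_measure preimage_bigcup !setI_bigcupr.
apply: (@measure_semi_sigma_additive _ _ _ (@lebesgue_measure RR)
  (fun n => I01 `&` (J `&` phi @^-1` F n))).
- by move=> i; exact: (mII mJ (mphi (mF i))).
- move=> i j _ _ [t [[_ [_ Fi]] [_ [_ Fj]]]]; apply: (tF i j) => //.
  by exists (phi t).
- by apply: bigcup_measurable => i _; exact: (mII mJ (mphi (mF i))).
Qed.

HB.instance Definition _ := isMeasure.Build _ _ _ nu nu0 nu_ge0 nu_sigma.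

End image_measure.

(** The points at distance more than [e] from the complement of [U], phrased with balls so that an
    empty complement is no exception. *)
Definition inner_nbhd (X : mmspace) (U : set (bcar X)) (e : RR) : set (bcar X) :=
  [set x | exists2 r, e < r & [set y | mm_d x y < r] `<=` U].

Lemma inner_nbhd_open X (U : set (bcar X)) e : d_open (@mm_d X) (inner_nbhd U e).
Proof.
move=> x [r er hr]; exists ((r - e) / 2); first by lra.
move=> y /= xy; exists ((r + e) / 2); first by lra.
by move=> z /= yz; apply: hr => /=; have := mm_d_tri x y z; lra.
Qed.

Lemma inner_nbhd_borel X (U : set (bcar X)) e : measurable (inner_nbhd U e).
Proof. exact: (@cborel_open X _ (inner_nbhd_open (U := U) (e := e))). Qed.

Lemma natSinv_le (m n : nat) : (m <= n)%N -> n.+1%:R^-1 <= m.+1%:R^-1 :> RR.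
Proof. by move=> mn; rewrite lef_pV2 ?posrE ?ltr0n // ler_nat ltnS. Qed.

Section law.
Variables (X : mmspace) (m1 m2 : {measure set (bcar X) -> \bar RR}).
Hypothesis m12T : m1 setT = m2 setT.
Hypothesis m1fin : (m1 setT < +oo)%E.
Hypothesis m12 : forall (U : set (bcar X)) (e : RR), d_open (@mm_d X) U -> 0 < e ->
  (m1 (inner_nbhd U e) <= m2 U + e%:E)%E.

Let open_borel (U : set (bcar X)) : d_open (@mm_d X) U -> measurable U.
Proof. exact: (@cborel_open X). Qed.

Let m12_open (U : set (bcar X)) : d_open (@mm_d X) U -> (m1 U <= m2 U)%E.
Proof.
move=> oU.
have bigU : \bigcup_n inner_nbhd U n.+1%:R^-1 = U.
  apply/seteqP; split => [x [n _ [r nr]]|x Ux].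
    apply; rewrite /= mm_d_refl; apply: lt_trans nr.
    by rewrite invr_gt0 ltr0n.
  have [e e0 he] := oU x Ux; have [n ne] := exists_natSinv_lt e0.
  by exists n => //; exists e.
have cv : (m1 \o (fun n : nat => inner_nbhd U n.+1%:R^-1)) n @[n --> \oo] --> m1 U.
  rewrite -[X in m1 X]bigU; apply: nondecreasing_cvg_mu.
  - by move=> n; exact: inner_nbhd_borel.
  - by rewrite bigU; exact: open_borel.
  - move=> m n mn; apply/subsetPset => x [r mr hr]; exists r => //.
    exact: le_lt_trans (natSinv_le mn) mr.
apply/lee_addgt0Pr => e e0.
rewrite -(cvg_lim _ cv) //; apply: lime_le; first by apply/cvg_ex; exists (m1 U).
have [n ne] := exists_natSinv_lt e0; exists n => // k /= nk.
apply: le_trans (m12 oU _) _; first by rewrite invr_gt0 ltr0n.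
by rewrite leeD2l // lee_fin; apply: le_trans (natSinv_le nk) (ltW ne).
Qed.

Let m2_closed (U : set (bcar X)) : d_open (@mm_d X) U -> (m2 (~` U) <= m1 (~` U))%E.
Proof.
move=> oU; have mU := open_borel oU.
have m2fin : (m2 setT < +oo)%E by rewrite -m12T.
rewrite -!setTD !measureD ?setTI //.
have le21 : (m2 setT <= m1 setT)%E by rewrite m12T.
by apply: leeB; [exact: le21|exact: m12_open].
Qed.

Let m21_open (U : set (bcar X)) : d_open (@mm_d X) U -> (m2 U <= m1 U)%E.
Proof.
move=> oU.
(* The complements of these open neighbourhoods of the complement of [U] are closed and increase to
   [U]. *)
pose G n := [set x : bcar X | exists2 y, ~ U y & mm_d x y < n.+1%:R^-1].
have oG n : d_open (@mm_d X) (G n).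
  move=> x [y nUy xy]; exists (n.+1%:R^-1 - mm_d x y); first by rewrite subr_gt0.
  move=> z /= xz; exists y => //; have := mm_d_tri z x y.
  by rewrite (mm_d_sym z x); move: (n.+1%:R^-1) xz => r *; lra.
have bigG : \bigcup_n ~` G n = U.
  apply/seteqP; split => [x [n _ nG]|x Ux].
    apply: contrapT => nU; apply: nG; exists x => //.
    by rewrite mm_d_refl invr_gt0 ltr0n.
  have [e e0 he] := oU x Ux; have [n ne] := exists_natSinv_lt e0.
  by exists n => // -[y nUy xy]; apply: nUy; apply: he => /=; exact: lt_trans ne.
have cv : (m2 \o (fun n => ~` G n)) n @[n --> \oo] --> m2 U.
  rewrite -[X in m2 X]bigG; apply: nondecreasing_cvg_mu.
  - by move=> n; apply: measurableC; exact: open_borel.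
  - by rewrite bigG; exact: open_borel.
  - move=> m n mn; apply/subsetPset => x nG [y nUy xy]; apply: nG; exists y => //.
    exact: lt_le_trans (natSinv_le mn).
rewrite -(cvg_lim _ cv) //; apply: lime_le; first by apply/cvg_ex; exists (m2 U).
near=> n; apply: le_trans (m2_closed (oG n)) _; apply: le_measure; rewrite ?inE.
- by apply: measurableC; exact: open_borel.
- exact: open_borel.
- by rewrite -bigG => x nG; exists n.
Unshelve. all: by end_near. Qed.

(** The hypothesis [m12] is a one-sided Levy-Prokhorov bound for every [e]. Letting [e] tend to 0
    gives [m1 <= m2] on open sets; equal total masses reverse this on closed sets, and exhausting
    open sets by closed ones gives equality on the open sets, a generating pi-system. *)
Lemma eq_law (B : set (bcar X)) : borel B -> m1 B = m2 B.
Proof.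
move=> bB; apply: (@measure_unique default_measure_display RR (bcar X)
  (d_open (@mm_d X)) (fun=> setT) erefl) => //.
- move=> A A' oA oA' x [Ax A'x].
  have [e e0 he] := oA x Ax; have [e' e'0 he'] := oA' x A'x.
  exists (Num.min e e') => [|y /=]; first by rewrite lt_min e0.
  by rewrite lt_min => /andP[h h']; split; [exact: he|exact: he'].
- by move=> _ x _; exists 1.
- by apply/seteqP; split => // x _; exists 0%N.
- by move=> A oA; apply/eqP; rewrite eq_le m12_open // m21_open.
Qed.

End law.

Lemma measure_bigcup_eq d d' (T : measurableType d) (T' : measurableType d')
    (m : {measure set T -> \bar RR}) (m' : {measure set T' -> \bar RR})
    (F : nat -> set T) (F' : nat -> set T') :
  (forall n, measurable (F n)) -> (forall n, measurable (F' n)) ->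
  trivIset setT F -> trivIset setT F' -> (forall n, m (F n) = m' (F' n)) ->
  m (\bigcup_n F n) = m' (\bigcup_n F' n).
Proof.
move=> mF mF' tF tF' e; rewrite !measure_bigcup //.
by apply: eq_eseriesr => n _; rewrite e.
Qed.

Definition mur (X : mmspace) (A : set (mm_car X)) : RR := fine (mm_mu A).

Section mur.
Variable X : mmspace.
Implicit Types A B : set (mm_car X).

Lemma mmu_fin A : borel A -> (mmu (X := X) A < +oo)%E.
Proof.
move=> bA; apply: (@le_lt_trans _ _ 1%E); last by rewrite ltry.
have bT := @cborelT X.
rewrite -(mm_mu_prob X) -mmuE //; apply: le_measure; rewrite ?inE //.
Qed.

Lemma murE A : borel A -> mm_mu A = (mur A)%:E.
Proof.
move=> bA; rewrite /mur fineK // -mmuE // ge0_fin_numE; last exact: measure_ge0.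
exact: mmu_fin.
Qed.

Lemma mur_ge0 A : borel A -> 0 <= mur A.
Proof. by move=> bA; rewrite -lee_fin -murE // mm_mu_ge0. Qed.

Lemma murT : mur (setT : set (mm_car X)) = 1.
Proof. by rewrite /mur mm_mu_prob. Qed.

Lemma mur0 : mur (set0 : set (mm_car X)) = 0.
Proof. by rewrite /mur mm_mu0. Qed.

Lemma murU A B : borel A -> borel B -> A `&` B = set0 ->
  mur (A `|` B) = mur A + mur B.
Proof.
move=> bA bB AB; have bU := @cborelU X A B bA bB.
apply: EFin_inj; rewrite EFinD -!murE // -!(mmuE (X := X)) //.
by apply: measureU.
Qed.

Lemma mur_le A B : borel A -> borel B -> A `<=` B -> mur A <= mur B.
Proof.
move=> bA bB AB; rewrite -lee_fin -!murE // -!(mmuE (X := X)) //.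
by apply: le_measure; rewrite ?inE.
Qed.

Section mur_label.
Variables (A : set (mm_car X)) (l : mm_car X -> nat).
Hypotheses (bA : borel A) (bl : forall c, borel [set x | l x = c]).

Lemma borel_label_lt n : borel [set x | (l x < n)%N].
Proof.
have -> : [set x | (l x < n)%N] =
    \bigcup_c (if (c < n)%N then [set x | l x = c] else set0).
  apply/seteqP; split => [x /= h|x [c _]]; first by exists (l x); rewrite ?h.
  by case: ifP => // cn /= ->.
apply: (@cborel_bigcup X) => c; case: ifP => _; first exact: bl.
exact: (@cborel0 X).
Qed.

Lemma mur_label_sum n :
  \sum_(0 <= c < n) mur (A `&` [set x | l x = c]) = mur (A `&` [set x | (l x < n)%N]).
Proof.
elim: n => [|n IHn].
  rewrite big_geq // (_ : _ `&` _ = set0) ?mur0 //.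
  by apply/seteqP; split => x // [].
rewrite big_nat_recr //= IHn -murU.
- congr mur; rewrite -setIUr; congr (_ `&` _); apply/seteqP; split => x /=.
    by case=> [/ltnW|->]; rewrite ltnS.
  by rewrite ltnS leq_eqVlt => /orP[/eqP|]; [right|left].
- by apply: (@cborelI X) => //; exact: borel_label_lt.
- by apply: (@cborelI X) => //; exact: bl.
- by apply/seteqP; split => x // [[_ /= h] [_ /= e]]; rewrite e ltnn in h.
Qed.

Lemma mur_label_cvg (e : RR) : 0 < e ->
  exists n, mur A - e < mur (A `&` [set x | (l x < n)%N]).
Proof.
move=> e0; pose F (n : nat) : set (bcar X) := A `&` [set x | (l x < n)%N].
have bF n : measurable (F n) by apply: (@cborelI X) => //; exact: borel_label_lt.
have bigF : \bigcup_n F n = A.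
  apply/seteqP; split => [x [n _ []//]|x Ax]; exists (l x).+1 => //.
  by split => /=.
have : (@mmu X \o F) n @[n --> \oo] --> mmu (A : set (bcar X)).
  rewrite -[X in mmu X]bigF; apply: nondecreasing_cvg_mu => //.
    by rewrite bigF.
  move=> m n mn; apply/subsetPset => x [Ax /= xm]; split => //=.
  exact: leq_trans mn.
rewrite mmuE // murE // => /fine_cvgP[_] /cvgrPdist_lt /(_ e e0)[N _ hN].
exists N; have := hN N (leqnn N); rewrite /= mmuE //; last exact: bF.
by rewrite -/(mur _) /F ltr_norml => /andP[_]; lra.
Qed.

End mur_label.
End mur.

Lemma lam_bigcup0 (F : nat -> set RR) : (forall n, mI (F n)) ->
  (forall n, lam (F n) = 0) -> lam (\bigcup_n F n) = 0.
Proof.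
move=> mF F0; have mU := mI_bigcup mF.
apply: EFin_inj; rewrite -lamE // setI_bigcupr.
apply/eqP; rewrite eq_le measure_ge0 andbT.
apply: le_trans (@generalized_Boole_inequality _ _ _ (@lebesgue_measure RR)
  (fun n => I01 `&` F n) _ _) _.
- by move=> n; exact: mF.
- by rewrite -setI_bigcupr.
- by rewrite eseries0 // => n _ _; have := lamE (mF n); rewrite F0.
Qed.

Lemma pickle_inv_inj (T : countType) (m n : nat) (w : T) :
  pickle_inv m = Some w -> pickle_inv n = Some w -> m = n.
Proof.
move=> em en; have := @pickle_invK T m; have := @pickle_invK T n.
by rewrite em en /= => <-.
Qed.

Section adapted_parameter.
Variables (X : mmspace) (l : mm_car X -> nat).
Hypothesis bl : forall c, borel [set x | l x = c].

(** The labelling [l] supplies the first letter of the tree, whose intervals then have exactly the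
    displayed endpoints. A limit point [phi t] may leave the fibre of [l] prescribed by the first
    letter; [Bad] collects these [t] and is null because the law of [phi] is right on each
    first-level interval. *)
Lemma adapted_parameter : exists phi : RR -> mm_car X, is_parameter phi /\
  exists Bad, [/\ mI Bad, lam Bad = 0 & forall t c, I01 t -> ~ Bad t ->
    \sum_(0 <= i < c) mur [set x | l x = i] <= t <
    \sum_(0 <= i < c.+1) mur [set x | l x = i] -> l (phi t) = c].
Proof.
have [L0 [bL0 L0small]] := exists_labels X.
pose L : nat -> ccar X -> nat := fun k => if k is k'.+1 then L0 k' else l.
have bL k c : @cborel X [set x | L k x = c].
  by case: k => [|k]; [exact: bl|exact: bL0].
have bcell w : borel (cell L w) by exact: (cborel_cell bL).
pose p w := mur (cell L w).
have tp : tree_mass p.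
  have sumE w n : \sum_(0 <= c < n) p (c :: w) =
      mur (cell L w `&` [set x | (L (size w) x < n)%N]).
    rewrite -mur_label_sum //; last by move=> c; exact: bL.
    by apply: eq_bigr => c _; rewrite /p cell_cons.
  split.
  - by move=> w; exact: mur_ge0.
  - by rewrite /p (_ : cell L [::] = setT) ?murT //; exact/seteqP.
  - move=> w n; rewrite sumE; apply: mur_le => //.
    exact: (@cborelI X _ _ (bcell w) (borel_label_lt (bL (size w)) n)).
  - move=> w e e0; have [n hn] := @mur_label_cvg X _ (L (size w)) (bcell w) (bL _) e e0.
    by exists n; rewrite sumE.
have pcell w : 0 < p w -> cell L w !=set0.
  move=> pw; apply/set0P; apply: contraTneq pw => e.
  by rewrite /p e mur0 ltxx.
have [phi [mphi phiP]] := @tree_limit X L p tp L0small pcell.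
pose J c := [set t | tree_word p 1 t = [:: c]].
have mJ c : mI (J c) by have [] := lam_tree_word tp [:: c].
have cellw1 c : cell L [:: c] = [set x | l x = c].
  by rewrite cell_cons; apply/seteqP; split => x /=; [case|].
have lamJ c : lam (J c) = mur [set x | l x = c].
  by have [_ ->] := lam_tree_word tp [:: c]; rewrite /p cellw1.
(* The laws are compared on each [J c] separately: the global law alone would not make [phi] respect
   [l] almost everywhere. *)
have law c B : borel B -> mmu (X := X) (B `&` [set x | l x = c]) =
    leb (I01 `&` (J c `&` phi @^-1` B)).
  pose m1 : {measure set (bcar X) -> \bar RR} :=
    mrestr (@mmu X) (bl c : measurable (_ : set (bcar X))).
  pose m2 : {measure set (bcar X) -> \bar RR} := image_measure mphi (mJ c).
  have m1T : m1 setT = (p [:: c])%:E.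
    by rewrite /m1 /= /mrestr setTI mmuE // murE // /p cellw1.
  have m2T : m2 setT = (p [:: c])%:E.
    by rewrite /m2 /= /image_measure preimage_setT setIT lamE // lamJ /p cellw1.
  move=> bB; apply: (@eq_law X m1 m2) => //; first by rewrite m1T m2T.
    by rewrite m1T ltry.
  move=> U e oU e0; have [k ke] := exists_natSinv_lt e0.
  apply: (@le_trans _ _ (m2 U)); last by rewrite leeDl // lee_fin ltW.
  (* Words with first letter [c] (stored last) whose cell meets the inner neighbourhood. The cells
     cover its part labelled [c], their intervals have the same total mass, and [phi] sends these
     into [U] because points with the same address are within [k.+1%:R^-1 < e] of [phi t]. *)
  pose W : set (seq nat) := [set w | [/\ size w = k.+2, last 0%N w = c &
    exists2 x, inner_nbhd (X := X) U e x & cell L w x]].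
  pose F (n : nat) : set (bcar X) := if pickle_inv n is Some w then
    (if `[< W w >] then cell L w else set0) else set0.
  pose G (n : nat) : set RR := if pickle_inv n is Some w then
    (if `[< W w >] then I01 `&` [set t | tree_word p (size w) t = w] else set0) else set0.
  have lastL j a x : last a (label_word L j.+1 x) = l x.
    by elim: j a => [|j IHj] a //=; exact: IHj.
  have lastT j a t : last a (tree_word p j.+1 t) = last 0%N (tree_word p 1 t).
    by elim: j a => [|j IHj] a //=; exact: IHj.
  have FG : mmu (\bigcup_n F n) = leb (\bigcup_n G n).
    apply: (measure_bigcup_eq (m := @mmu X) (m' := @lebesgue_measure RR)).
    - by move=> n; rewrite /F; case: pickle_inv => // w; case: ifP => // _; exact: bcell.
    - move=> n; rewrite /G; case: pickle_inv => // w; case: ifP => // _.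
      by have [] := lam_tree_word tp w.
    - move=> m n _ _ [x []]; rewrite /F.
      case em: (pickle_inv m) => [w|//]; case en: (pickle_inv n) => [w'|//].
      case: asboolP => // -[sw _ _]; case: asboolP => // -[sw' _ _].
      rewrite /cell /= sw sw' => wx w'x; rewrite -wx in em; rewrite -w'x in en.
      exact: pickle_inv_inj em en.
    - move=> m n _ _ [t []]; rewrite /G.
      case em: (pickle_inv m) => [w|//]; case en: (pickle_inv n) => [w'|//].
      case: asboolP => // -[sw _ _]; case: asboolP => // -[sw' _ _].
      rewrite /= sw sw' => -[_ wt] [_ w't]; rewrite -wt in em; rewrite -w't in en.
      exact: pickle_inv_inj em en.
    - move=> n; rewrite /F /G; case: pickle_inv => [w|]; last by rewrite !measure0.
      case: ifP => _; last by rewrite !measure0.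
      have [mw lw] := lam_tree_word tp w.
      transitivity (p w)%:E; first exact: (etrans (mmuE (bcell w)) (murE (bcell w))).
      by rewrite -lw; exact: (esym (lamE mw)).
  apply: (@le_trans _ _ (mmu (\bigcup_n F n))).
    apply: le_measure; rewrite ?inE.
    - by apply: measurableI; [exact: inner_nbhd_borel|exact: bl].
    - apply: bigcup_measurable => n _; rewrite /F; case: pickle_inv => // w.
      by case: ifP => // _; exact: bcell.
    - move=> x [Ux lx]; pose w := label_word L k.+2 x.
      exists (pickle w) => //; rewrite /F pickleK_inv.
      have wx : cell L w x by rewrite /cell /= size_label_word.
      rewrite asboolT //; split; [exact: size_label_word|by rewrite lastL|by exists x].
  rewrite FG; apply: le_measure; rewrite ?inE.
  - apply: bigcup_measurable => n _; rewrite /G; case: pickle_inv => // w.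
    by case: ifP => // _; have [] := lam_tree_word tp w.
  - exact: (mII (mJ c) (mphi _ (@cborel_open X U oU))).
  - move=> t [n _]; rewrite /G; case: pickle_inv => // w.
    case: asboolP => // -[sw lw [x [r er hr] wx]] [It wt].
    rewrite /cell /= sw in wt wx; split => //; split.
      rewrite /J /=; have := lastT k.+1 0%N t; rewrite wt lw /=.
      by move=> ->.
    apply: hr => /=; apply: le_lt_trans (lt_trans ke er).
    by apply: phiP => //; rewrite wt.
have lawr c B : borel B -> mur (B `&` [set x | l x = c]) = lam (J c `&` phi @^-1` B).
  move=> bB; have bI := @cborelI X _ _ bB (bl c).
  by rewrite /lam -law // mmuE.
exists phi; split.
  split => B bB; first exact: mphi.
  have BE : B = \bigcup_c (B `&` [set x | l x = c]).
    by apply/seteqP; split => [x Bx|x [c _ []//]]; exists (l x).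
  have PE : I01 `&` phi @^-1` B = \bigcup_c (I01 `&` (J c `&` phi @^-1` B)).
    apply/seteqP; split => [t [It Bt]|t [c _ [It [_ Bt]]]] //.
    exists (head 0%N (tree_word p 1 t)) => //.
  rewrite -mmuE // [in RHS]BE PE; apply/esym.
  apply: (measure_bigcup_eq (m := @mmu X) (m' := @lebesgue_measure RR)).
  - by move=> c; apply: measurableI => //; exact: bl.
  - by move=> c; exact: (mII (mJ c) (mphi _ bB)).
  - by move=> c c' _ _ [x [[_ /= <-] [_ /= <-]]].
  - by move=> c c' _ _ [t [[_ [ct _]] [_ [c't _]]]]; have := etrans (esym ct) c't; case.
  - by move=> c; exact: law.
exists (\bigcup_c (J c `&` phi @^-1` (~` [set x | l x = c]))).
have mB c : mI (J c `&` phi @^-1` (~` [set x | l x = c])).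
  by apply: mII => //; apply: mphi; apply: (@cborelC X); exact: bl.
split; first exact: mI_bigcup.
  apply: lam_bigcup0 => // c; rewrite -lawr; last by apply: (@cborelC X); exact: bl.
  by rewrite setICl mur0.
move=> t c It nB; rewrite big_nat_recr //= => ht.
apply: contrapT => nl; apply: nB; exists c => //; split => //.
apply/(tree_wordP tp [:: c] It); rewrite /tree_itv /= add0r.
have E i : p [:: i] = mur [set x | l x = i] by rewrite /p cellw1.
by rewrite E (eq_bigr (fun i => mur [set x | l x = i])).
Qed.

End adapted_parameter.

(** * Measure-preserving maps and gluing *)

Lemma parameter_mur (X : mmspace) (phi : RR -> mm_car X) B :
  is_parameter phi -> borel B -> mur B = lam (phi @^-1` B).
Proof. by move=> pphi bB; rewrite /mur (parameter_lam pphi bB). Qed.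

Lemma exists_parameter (X : mmspace) : exists phi : RR -> mm_car X, is_parameter phi.
Proof.
have [|phi [pphi _]] := @adapted_parameter X (fun=> 0%N); last by exists phi.
case=> [|c].
  by rewrite (_ : [set _ | _] = setT); [exact: (@cborelT X)|exact/seteqP].
by rewrite (_ : [set _ | _] = set0); [exact: (@cborel0 X)|apply/seteqP; split => x].
Qed.

Definition msp (tau : RR -> RR) : Prop := (forall t, I01 (tau t)) /\
  forall A, mI A -> mI (tau @^-1` A) /\ lam (tau @^-1` A) = lam A.

Lemma parameter_msp (X : mmspace) (phi : RR -> mm_car X) tau :
  is_parameter phi -> msp tau -> is_parameter (phi \o tau).
Proof.
move=> pphi [_ mtau]; split => B bB; have [m e] := mtau _ (parameter_bmeas pphi bB).
  exact: m.
by rewrite (parameter_lam pphi bB) -e; exact: lamE.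
Qed.

Lemma msp_comp tau tau' : msp tau -> msp tau' -> msp (tau \o tau').
Proof.
move=> [I1 m1] [I2 m2]; split => [t|A mA]; first exact: I1.
have [m1A e1] := m1 A mA; have [m2A e2] := m2 _ m1A.
by split; [exact: m2A|rewrite -e1 -e2].
Qed.

(** A parameter of [Ispace] may leave [I01] on a null set, whereas [msp] asks for values in [I01]
    everywhere; the stray values are sent to 0. *)
Definition proj01 (t : RR) : RR := if 0 <= t < 1 then t else 0.

Lemma proj01P t : I01 (proj01 t).
Proof. by apply/I01P; rewrite /proj01; case: ifP => // _; lra. Qed.

Lemma proj01_id t : I01 t -> proj01 t = t.
Proof. by move=> /I01P; rewrite /proj01 => ->. Qed.

Lemma proj01_measurable A : mI A -> measurable (proj01 @^-1` A).
Proof.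
move=> mA.
have -> : proj01 @^-1` A = (I01 `&` A) `|` (if `[< A 0 >] then ~` I01 else set0).
  apply/seteqP; split => t.
    have [It|nIt] := pselect (I01 t); first by rewrite /= proj01_id //; left.
    rewrite /= /proj01; case: ifP => [/I01P//|_ A0]; right.
    by rewrite asboolT.
  case=> [[It At]|]; first by rewrite /= proj01_id.
  case: asboolP => // A0 nIt /=; rewrite /proj01.
  by case: ifP => // /I01P.
apply: measurableU => //; case: ifP => _ //.
by apply: measurableC; exact: measurable_I01.
Qed.

Lemma Iparameter_msp (tau : RR -> RR) :
  is_parameter (X := Ispace) tau -> msp (proj01 \o tau).
Proof.
move=> ptau; split => [t|A mA]; first exact: proj01P.
have bA := measurable_Rborel (proj01_measurable mA).
split; first exact: (parameter_bmeas ptau bA).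
rewrite -(parameter_mur (X := Ispace) ptau bA).
rewrite (parameter_mur (push_parameter bmeas_id) bA).
by apply: eq_lam => t It /=; rewrite proj01_id.
Qed.

Section interval_labels.
Variable a : RR -> nat.
Hypothesis ma : forall c, mI [set t | a t = c].

Lemma mI_label_lt n : mI [set t | (a t < n)%N].
Proof.
have := mI_bigcup_count (S := [set c | (c < n)%N]) (fun c _ => ma c).
by apply: eq_mI => t _; split => [[c /= cn ->//]|/= h]; exists (a t).
Qed.

Lemma lam_label_sum n :
  \sum_(0 <= c < n) lam [set t | a t = c] = lam [set t | (a t < n)%N].
Proof.
elim: n => [|n IHn].
  by rewrite big_geq // -[LHS]lam0; apply: eq_lam => t.
rewrite big_nat_recr //= IHn -lamU //.
- apply: eq_lam => t _ /=; rewrite ltnS; split.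
    by case=> [/ltnW|->].
  by rewrite leq_eqVlt => /orP[/eqP|]; [right|left].
- exact: mI_label_lt.
- by move=> t _ /= h e; rewrite e ltnn in h.
Qed.

Lemma lam_label_cover (e : RR) : 0 < e ->
  exists n, 1 - e < \sum_(0 <= c < n) lam [set t | a t = c].
Proof.
move=> e0; have [N hN] := lam_cover_cvg (F := fun n => [set t | (a t < n)%N]) mI_label_lt
  (fun m n t mn _ (h : (a t < m)%N) => leq_trans h mn)
  (fun t _ => ex_intro _ (a t).+1 (leqnn _)) e0.
by exists N; rewrite lam_label_sum; exact: hN.
Qed.

Lemma adapted_msp : exists tau, msp tau /\
  exists Bad, [/\ mI Bad, lam Bad = 0 & forall t c, I01 t -> ~ Bad t ->
    \sum_(0 <= i < c) lam [set t | a t = i] <= t <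
    \sum_(0 <= i < c.+1) lam [set t | a t = i] -> a (tau t) = c].
Proof.
have bl c : borel (X := Ispace) [set t | a (proj01 t) = c].
  exact: (measurable_Rborel (proj01_measurable (ma c))).
have [tau [ptau [Bad [mB B0 hB]]]] := adapted_parameter bl.
exists (proj01 \o tau); split; first exact: Iparameter_msp.
exists Bad; split => // t c It nB h; apply: hB => //.
have E i : mur (X := Ispace) [set t | a (proj01 t) = i] = lam [set t | a t = i].
  rewrite (parameter_mur (push_parameter bmeas_id) (bl i)).
  by apply: eq_lam => s Is /=; rewrite proj01_id.
by rewrite !(eq_bigr _ (fun i _ => E i)).
Qed.

End interval_labels.

Section adapted_msp_sub.
Variables (a : RR -> nat) (m : nat -> RR) (N : nat).
Hypothesis ma : forall c, mI [set t | a t = c].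
Hypothesis m_ge0 : forall c, (c < N)%N -> 0 <= m c.
Hypothesis m_le : forall c, (c < N)%N -> m c <= lam [set t | a t = c].

(** Two sortings are composed. The map [tau0] puts the labels of [a] on consecutive intervals; [b]
    keeps the initial piece of length [m c] of the interval of [c], and [tau1] lines these pieces up
    without gaps. *)
Lemma adapted_msp_sub : exists tau, msp tau /\
  exists Bad, [/\ mI Bad, lam Bad = 0 & forall t c, I01 t -> ~ Bad t -> (c < N)%N ->
    \sum_(0 <= i < c) m i <= t < \sum_(0 <= i < c.+1) m i -> a (tau t) = c].
Proof.
have [tau0 [mtau0 [Bad0 [mB0 B00 hB0]]]] := adapted_msp ma.
pose M c := \sum_(0 <= i < c) lam [set t | a t = i].
have MS c : M c.+1 = M c + lam [set t | a t = c] by rewrite /M big_nat_recr.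
have M_mono : {homo M : c d / (c <= d)%N >-> c <= d}.
  apply: homo_leq => [//|? ? ?|n]; first exact: le_trans.
  by rewrite MS lerDl lam_ge0.
have M1 c : M c <= 1.
  by rewrite /M (lam_label_sum ma); apply: lam_le1; exact: (mI_label_lt ma).
have M0 : M 0%N = 0 by rewrite /M big_geq.
pose P (t : RR) c := M c <= t < M c + m c.
have Puniq t c d : (c < N)%N -> (d < N)%N -> P t c -> P t d -> c = d.
  move=> cN dN; rewrite /P => /andP[h1 h2] /andP[h3 h4].
  have := m_le cN; have := m_le dN.
  by case: (ltngtP c d) => // /M_mono; rewrite MS => ? ? ?; exfalso; lra.
(* Where no piece contains [t], [find] returns [N], which thus labels the remainder. *)
pose b t := find (P t) (iota 0 N).
have bP t c : (c < N)%N -> b t = c <-> P t c.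
  move=> cN; split => [bc|Pc].
    have hs : has (P t) (iota 0 N) by rewrite has_find -/(b t) bc size_iota.
    by have := nth_find 0%N hs; rewrite -/(b t) bc nth_iota.
  have hs : has (P t) (iota 0 N) by apply/hasP; exists c => //; rewrite mem_iota.
  have := nth_find 0%N hs; rewrite has_find size_iota in hs.
  by rewrite nth_iota // add0n -/(b t) => Pb; apply: (Puniq t).
have itv c : (c < N)%N -> mI [set t | P t c] /\ lam [set t | P t c] = m c.
  move=> cN; have := M_mono _ _ (leq0n c); have := M1 c.+1; rewrite MS M0.
  have h1 := m_ge0 cN; have h2 := m_le cN => h3 h4.
  have [k1 k2] := @lam_itvco (M c) (M c + m c) h4 ltac:(lra) ltac:(lra).
  have E t : I01 t -> (`[M c, M c + m c[%classic : set RR) t <-> P t c.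
    by rewrite /= in_itv.
  by split; [exact: eq_mI k1|rewrite -(eq_lam E) k2; lra].
have mb c : mI [set t | b t = c].
  have [cN|Nc] := ltnP c N; first by apply: eq_mI (itv c cN).1 => t _; split => /bP; apply.
  have [->|cN] := eqVneq c N.
    have := mI_bigcup_count (S := [set c | (c < N)%N]) (fun c cN => (itv c cN).1).
    move=> /mIC; apply: eq_mI => t _; split => [h|/= bN [c' /= cN' /bP]].
      have : (b t <= N)%N by rewrite -[X in (_ <= X)%N](size_iota 0 N) find_size.
      rewrite leq_eqVlt => /orP[/eqP//|bN]; exfalso; apply: h.
      by exists (b t) => //=; apply/bP.
    by move=> /(_ cN') bc; rewrite -bN bc ltnn in cN'.
  apply: eq_mI mI0 => t _; split => //= bc.
  have : (b t <= N)%N by rewrite -[X in (_ <= X)%N](size_iota 0 N) find_size.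
  by rewrite bc leqNgt ltn_neqAle eq_sym cN Nc.
have lamb c : (c < N)%N -> lam [set t | b t = c] = m c.
  by move=> cN; rewrite -(itv c cN).2; apply: eq_lam => t _; exact: bP.
have [tau1 [mtau1 [Bad1 [mB1 B10 hB1]]]] := adapted_msp mb.
have [mT1 T1] := mtau1.2 _ mB0.
exists (tau0 \o tau1); split; first exact: msp_comp.
exists (Bad1 `|` tau1 @^-1` Bad0); split; first exact: mIU.
  by apply/eqP; rewrite eq_le lam_ge0 andbT (le_trans (lamU_le _ _)) // B10 T1 B00 addr0.
move=> t c It /not_orP[nB1 nB0] cN ht.
have sumE d : (d <= N)%N -> \sum_(0 <= i < d) lam [set t | b t = i] = \sum_(0 <= i < d) m i.
  move=> dN; apply: eq_big_nat => i /andP[_ id]; apply: lamb.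
  exact: leq_trans dN.
have : b (tau1 t) = c by apply: hB1 => //; rewrite !sumE // ltnW.
move/bP => /(_ cN) /andP[h1 h2]; apply: hB0 => //; first exact: mtau1.1.
by rewrite -!/(M _) h1 /= (lt_le_trans h2) // MS lerD2l m_le.
Qed.

End adapted_msp_sub.

(** Both labellings are sorted onto the same consecutive intervals of lengths [m c]. They then agree
    up to the sum of the [m c], apart from null sets; beyond that point nothing is controlled. *)
Lemma relabel (a b : RR -> nat) (m : nat -> RR) (N : nat) :
  (forall c, mI [set t | a t = c]) -> (forall c, mI [set t | b t = c]) ->
  (forall c, (c < N)%N -> 0 <= m c) ->
  (forall c, (c < N)%N -> m c <= lam [set t | a t = c]) ->
  (forall c, (c < N)%N -> m c <= lam [set t | b t = c]) ->
  exists tau tau' Bad, [/\ msp tau, msp tau', mI Bad,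
    lam Bad <= 1 - \sum_(0 <= c < N) m c & forall t, I01 t -> ~ Bad t ->
    a (tau t) = b (tau' t) /\ (a (tau t) < N)%N].
Proof.
move=> ma mb m0 mla mlb.
have [tau [mtau [Bad [mB B0 hB]]]] := adapted_msp_sub ma m0 mla.
have [tau' [mtau' [Bad' [mB' B0' hB']]]] := adapted_msp_sub mb m0 mlb.
pose S := \sum_(0 <= c < N) m c.
have S0 : 0 <= S.
  by rewrite /S big_nat_cond sumr_ge0 // => i /andP[/andP[_ iN] _]; exact: m0.
have S1 : S <= 1.
  apply: (@le_trans _ _ (\sum_(0 <= c < N) lam [set t | a t = c])).
    by apply: ler_sum_nat => i /andP[_ iN]; exact: mla.
  by rewrite lam_label_sum //; apply: lam_le1; exact: mI_label_lt.
have [mS lS] := lam_itvco S0 S1 (lexx 1).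
exists tau, tau', ((Bad `|` Bad') `|` `[S, 1[%classic); split => //.
- by apply: mIU => //; exact: mIU.
- apply: le_trans (lamU_le _ _) _ => //; first exact: mIU.
  by rewrite lS -/S; have := lamU_le mB mB'; rewrite B0 B0'; lra.
move=> t It /not_orP[/not_orP[nB nB'] nS].
have tS : t < S.
  rewrite ltNge; apply/negP => St; apply: nS; move/I01P: It => It.
  by rewrite /= in_itv /= St; lra.
have [c cN hc] : exists2 c, (c < N)%N &
    \sum_(0 <= i < c) m i <= t < \sum_(0 <= i < c.+1) m i.
  rewrite /S in tS; have ex : exists n, t < \sum_(0 <= i < n) m i by exists N.
  case: (ex_minnP ex) => -[|c] hc hmin.
    by move: hc; rewrite big_geq //; move/I01P: It; lra.
  exists c; first exact: hmin.
  by rewrite hc andbT leNgt; apply/negP => /hmin; rewrite ltnn.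
by rewrite (hB t c) // (hB' t c).
Qed.

Lemma mI_label (X : mmspace) (phi : RR -> mm_car X) (l : mm_car X -> nat) :
  @bmeas X phi -> (forall c, borel [set x | l x = c]) ->
  forall c, mI [set t | l (phi t) = c].
Proof. by move=> mphi bl c; exact: (mphi _ (bl c)). Qed.

(** Equal laws give the cells of a partition equal masses under [phi] and [phi'], so [relabel] puts
    both points in the same cell, within [e / 2] of its centre. Truncating to finitely many labels
    costs the rest of the error. *)
Lemma glue (Y : mmspace) (phi phi' : RR -> mm_car Y) (e : RR) :
  is_parameter phi -> is_parameter phi' -> 0 < e ->
  exists tau tau' Bad, [/\ msp tau, msp tau', mI Bad, lam Bad <= e &
    forall t, I01 t -> ~ Bad t -> mm_d (phi (tau t)) (phi' (tau' t)) <= e].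
Proof.
move=> pphi pphi' e0.
have [l [bl [s hs]]] := exists_label Y (divr_gt0 e0 (ltr0n RR 2)).
have ma := mI_label (parameter_bmeas pphi) bl.
have mb := mI_label (parameter_bmeas pphi') bl.
have [N hN] := lam_label_cover ma e0.
have E c : lam [set t | l (phi t) = c] = lam [set t | l (phi' t) = c].
  have := parameter_mur pphi (bl c); rewrite (parameter_mur pphi' (bl c)).
  by move=> <-.
have [||tau [tau' [Bad [mtau mtau' mB lB hB]]]] :=
  @relabel _ _ (fun c => lam [set t | l (phi t) = c]) N ma mb (fun c _ => lam_ge0 _).
- by move=> c _.
- by move=> c _; rewrite E.
exists tau, tau', Bad; split => //; first by lra.
move=> t It nB; have [h _] := hB t It nB.
have h1 := hs (phi (tau t)); have h2 := hs (phi' (tau' t)); rewrite -h in h2.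
change (@cdist Y (phi (tau t)) (phi' (tau' t)) <= e).
have := @cdist_tri Y (phi (tau t)) (s (l (phi (tau t)))) (phi' (tau' t)).
by rewrite (cdist_sym (phi (tau t)) (s _)); lra.
Qed.

(** * The box distance through explicit parameters *)

(** This is [box_adm] with the parameters kept visible, as gluing must act on them, and with the
    exceptional set in place of the good one. *)
Definition pnear (X Y : mmspace) (phi : RR -> mm_car X) (psi : RR -> mm_car Y)
    (e : RR) : Prop :=
  [/\ is_parameter phi, is_parameter psi & exists Bad,
    [/\ mI Bad, lam Bad <= e & forall s t, I01 s -> I01 t -> ~ Bad s -> ~ Bad t ->
      `|mm_d (phi s) (phi t) - mm_d (psi s) (psi t)| <= e]].

Lemma pnear_ge0 X Y phi psi e : @pnear X Y phi psi e -> 0 <= e.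
Proof. by move=> [_ _ [Bad [_ h _]]]; apply: le_trans h; exact: lam_ge0. Qed.

Lemma pnear_sym X Y phi psi e : @pnear X Y phi psi e -> pnear psi phi e.
Proof.
move=> [p1 p2 [Bad [mB lB hB]]]; split => //; exists Bad; split => //.
by move=> s t *; rewrite distrC; exact: hB.
Qed.

Lemma pnear_msp X Y phi psi e tau : @pnear X Y phi psi e -> msp tau ->
  pnear (phi \o tau) (psi \o tau) e.
Proof.
move=> [p1 p2 [Bad [mB lB hB]]] mtau; split; [exact: parameter_msp..|].
have [m E] := mtau.2 _ mB; exists (tau @^-1` Bad); split => //; first by rewrite E.
by move=> s t Is It nBs nBt; apply: hB => //; exact: mtau.1.
Qed.

Lemma pnear_trans X Y Z phi psi xi e e' : @pnear X Y phi psi e -> @pnear Y Z psi xi e' ->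
  pnear phi xi (e + e').
Proof.
move=> [p1 p2 [Bad [mB lB hB]]] [_ p3 [Bad' [mB' lB' hB']]]; split => //.
exists (Bad `|` Bad'); split; first exact: mIU.
  by apply: le_trans (lamU_le mB mB') _; exact: lerD.
move=> s t Is It /not_orP[n1 n2] /not_orP[n3 n4].
have := hB s t Is It n1 n3; have := hB' s t Is It n2 n4.
by rewrite !ler_norml; lra.
Qed.

Lemma pnear_refl X (phi : RR -> mm_car X) e : is_parameter phi -> 0 <= e -> pnear phi phi e.
Proof.
move=> pphi e0; split => //; exists set0; split; rewrite ?lam0 //; first exact: mI0.
by move=> s t *; rewrite subrr normr0.
Qed.

(** The composable half of the triangle inequality: [psi] is exchanged for a prescribed parameter
    [chi] of the same space. *)
Lemma pnear_glue X Y phi psi e (chi : RR -> mm_car Y) (e' : RR) :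
  @pnear X Y phi psi e -> is_parameter chi -> 0 < e' ->
  exists tau tau', [/\ msp tau, msp tau' & pnear (phi \o tau) (chi \o tau') (e + e')].
Proof.
move=> np pchi e'0; have [p1 p2 _] := np.
have [tau [tau' [Bad [mtau mtau' mB lB hB]]]] := glue p2 pchi (divr_gt0 e'0 (ltr0n RR 2)).
exists tau, tau'; split => //; apply: pnear_trans (pnear_msp np mtau) _.
split; [exact: parameter_msp..|]; exists Bad; split => //; first by lra.
move=> s t Is It nBs nBt; have -> : e' = 2 * (e' / 2) by lra.
apply: (@cdist_quad Y); rewrite cdist_sym; exact: hB.
Qed.

Lemma pnear_box_adm X Y phi psi e : @pnear X Y phi psi e -> box_adm X Y e.
Proof.
move=> np; split; first exact: pnear_ge0 np.
have [p1 p2 [Bad [mB lB hB]]] := np.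
exists phi, psi; split => //; split => //; exists (I01 `&` ~` Bad).
have mC := mIC mB; split => //; split; first by move=> t [].
split; first by rewrite lamE // lee_fin lamC //; lra.
by move=> s t [Is ns] [It nt]; exact: hB.
Qed.

Lemma box_adm_pnear X Y e : box_adm X Y e -> exists phi psi, @pnear X Y phi psi e.
Proof.
move=> [e0 [phi [psi [p1 [p2 [I0 [mI0' [I0I [lI0 h]]]]]]]]].
exists phi, psi; split => //.
have mI0 := mI_measurable mI0'.
exists (~` I0); split; first exact: mIC.
  move: lI0; rewrite -[X in leb X](setIidr I0I) lamE // lee_fin lamC //; lra.
by move=> s t _ _ /contrapT ? /contrapT ?; exact: h.
Qed.

Lemma pnear_box X Y phi psi e : @pnear X Y phi psi e -> box X Y <= e.
Proof.
by move=> /pnear_box_adm h; apply: inf_nneg_le => // y [].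
Qed.

Lemma box_ge0 X Y : 0 <= box X Y.
Proof. by apply: inf_nneg_ge0 => y []. Qed.

Lemma box_lt_pnear X Y e : box X Y < e ->
  exists phi psi e', @pnear X Y phi psi e' /\ e' < e.
Proof.
have [phi pphi] := exists_parameter X; have [psi ppsi] := exists_parameter Y.
(* With the whole interval exceptional 1 is admissible, so the infimum is over a nonempty set. *)
have adm1 : box_adm X Y 1.
  apply: (@pnear_box_adm _ _ phi psi); split => //; exists setT; split => //.
  - exact: mIT.
  - by rewrite lamT.
  - by move=> s t _ _ [].
move=> h; have [e' adm e'e] := inf_nneg_lt (fun y (a : box_adm X Y y) => a.1) adm1 h.
by have [phi' [psi' np]] := box_adm_pnear adm; exists phi', psi', e'.
Qed.

Lemma box_sym_lt X Y e : box X Y < e -> box Y X < e.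
Proof.
move=> /box_lt_pnear[phi [psi [e' [/pnear_sym/pnear_box h e'e]]]].
exact: le_lt_trans e'e.
Qed.

Lemma box_refl X : box X X = 0.
Proof.
have [phi pphi] := exists_parameter X.
apply/eqP; rewrite eq_le box_ge0 andbT.
exact: (pnear_box (pnear_refl pphi (lexx 0))).
Qed.

(** Strict bounds provide actual parameters, and the slack [a - a'] pays for the gluing. *)
Lemma box_tri_lt X Y Z a b : box X Y < a -> box Y Z < b -> box X Z < a + b.
Proof.
move=> /box_lt_pnear[phi [psi [a' [n1 h1]]]] /box_lt_pnear[psi' [xi [b' [n2 h2]]]].
have [p _ _] := n2.
have e0 : 0 < a - a' by lra.
have [tau [tau' [mtau mtau' n3]]] := pnear_glue n1 p e0.
have := pnear_box (pnear_trans n3 (pnear_msp n2 mtau')); lra.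
Qed.

(** Nonemptiness matters: the infimum over an empty family would be 0. *)
Lemma box_set_lt X P e : P !=set0 -> box_set X P < e -> exists2 Y, P Y & box X Y < e.
Proof.
move=> [Y0 P0] h.
have [|y [Y PY ->] ye] := inf_nneg_lt _ (ex_intro2 _ _ Y0 P0 erefl) h.
  by move=> y [Y _ ->]; exact: box_ge0.
by exists Y.
Qed.

Lemma box_set_le X P Y : P Y -> box_set X P <= box X Y.
Proof.
by move=> PY; apply: inf_nneg_le; [move=> y [Z _ ->]; exact: box_ge0|exists Y].
Qed.

Lemma box_set_ge0 X P : 0 <= box_set X P.
Proof. by apply: inf_nneg_ge0 => y [Z _ ->]; exact: box_ge0. Qed.

(** * Observable distance *)

Lemma lip1_clip1 (X : mmspace) (f : mm_car X -> RR) : lip1 f -> @clip1 X Rcms f.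
Proof. by []. Qed.

Lemma lip1_bmeas (X : mmspace) (f : mm_car X -> RR) (phi : RR -> mm_car X) :
  lip1 f -> is_parameter phi -> @bmeas Rcms (f \o phi).
Proof.
by move=> lf pphi; exact: (bmeas_clip1 (lip1_clip1 lf) (parameter_bmeas pphi)).
Qed.

Lemma dKF_sym u v : dKF u v = dKF v u.
Proof.
rewrite /dKF; congr inf; apply/seteqP.
by split => e /= [e0]; under eq_set do rewrite distrC.
Qed.

Section dKF_measurable.
Variables u v : RR -> RR.
Hypotheses (mu : @bmeas Rcms u) (mv : @bmeas Rcms v).

Lemma dKF_le e : 0 <= e -> lam [set s | e < `|u s - v s|] <= e -> dKF u v <= e.
Proof.
move=> e0 h; apply: inf_nneg_le; first by move=> y [].
by split => //; rewrite lamE ?lee_fin //; exact: mI_dist_gt.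
Qed.

Lemma dKF_lt e : dKF u v < e -> exists Bad, [/\ mI Bad, lam Bad <= e &
  forall t, I01 t -> ~ Bad t -> `|u t - v t| <= e].
Proof.
move=> h; have [||e' [e'0 he'] e'e] := @inf_nneg_lt _ 1 e _ _ h; first by move=> y [].
  split => //; rewrite lamE; last exact: mI_dist_gt.
  by rewrite lee_fin; apply: lam_le1; exact: mI_dist_gt.
have m := mI_dist_gt e' mu mv; rewrite lamE // lee_fin in he'.
exists [set s | e' < `|u s - v s|]; split => //; first by lra.
by move=> t _ /negP; rewrite -leNgt; lra.
Qed.

Lemma dKF_le1 : dKF u v <= 1.
Proof. by apply: dKF_le => //; apply: lam_le1; exact: mI_dist_gt. Qed.

End dKF_measurable.

Lemma dH_KF_ge0 A B : 0 <= dH_KF A B.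
Proof. by apply: inf_nneg_ge0 => e []. Qed.

Lemma lip1_cst0 (X : mmspace) : lip1 (fun _ : mm_car X => 0).
Proof. by move=> x y; rewrite subrr normr0; exact: (@cdist_ge0 X). Qed.

Lemma dH_KF_lip1_lt (X Y : mmspace) (phi : RR -> mm_car X) (psi : RR -> mm_car Y) e :
  is_parameter phi -> is_parameter psi ->
  dH_KF (lip1_param phi) (lip1_param psi) < e ->
  forall f, lip1 f -> exists2 g, lip1 g & dKF (f \o phi) (g \o psi) < e.
Proof.
move=> pphi ppsi h f lf.
(* The Ky Fan distance is at most 1, so 2 is admissible in [dH_KF] despite the strict inequalities,
   and the infimum is a genuine one. *)
have lt2 f' g' : lip1 f' -> lip1 g' -> dKF (f' \o phi) (g' \o psi) < 2.
  move=> lf' lg'; have := dKF_le1 (lip1_bmeas lf' pphi) (lip1_bmeas lg' ppsi); lra.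
have [||r [r0 [hr _]] re] := @inf_nneg_lt _ 2 e _ _ h; first by move=> y [].
  split; first by lra.
  split => [_ [f' lf' ->]|_ [g' lg' ->]].
    exists ((fun=> 0) \o psi); last by apply: lt2 => //; exact: lip1_cst0.
    by exists (fun=> 0) => //; exact: lip1_cst0.
  exists ((fun=> 0) \o phi); last by apply: lt2 => //; exact: lip1_cst0.
  by exists (fun=> 0) => //; exact: lip1_cst0.
have [_ [g lg ->] fg] := hr _ (ex_intro2 _ _ f lf erefl).
by exists g => //; exact: lt_trans re.
Qed.

Lemma dconc_lt (X Y : mmspace) e : dconc X Y < e ->
  exists (phi : RR -> mm_car X) (psi : RR -> mm_car Y),
  [/\ is_parameter phi, is_parameter psi &
    forall f, lip1 f -> exists2 g, lip1 g & dKF (f \o phi) (g \o psi) < e].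
Proof.
have [phi0 pphi0] := exists_parameter X; have [psi0 ppsi0] := exists_parameter Y.
move=> h; have [||r [phi [psi [pphi [ppsi ->]]]] re] :=
  @inf_nneg_lt _ (dH_KF (lip1_param phi0) (lip1_param psi0)) e _ _ h.
- by move=> y [? [? [_ [_ ->]]]]; exact: dH_KF_ge0.
- by exists phi0, psi0.
by exists phi, psi; split => //; exact: dH_KF_lip1_lt.
Qed.

(* McShane's extension of [f \o phi], transported to [Y] along the good set.  When
   the good set is empty the infimum is the junk value [0], which still works. *)
Lemma pnear_lip1 (X Y : mmspace) (phi : RR -> mm_car X) (psi : RR -> mm_car Y) e :
  pnear phi psi e -> forall f, lip1 f ->
  exists2 g, lip1 g & dKF (f \o phi) (g \o psi) <= e.
Proof.
move=> np f lf; have e0 := pnear_ge0 np; have [pphi ppsi [Bad [mB lB hB]]] := np.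
pose S y := [set r | exists s, [/\ I01 s, ~ Bad s & r = f (phi s) + mm_d (psi s) y]].
pose g y := inf (S y).
have Slb y s0 : I01 s0 -> ~ Bad s0 -> lbound (S y) (f (phi s0) - e - mm_d (psi s0) y).
  move=> Is0 ns0 _ [s [Is ns ->]].
  have := lf (phi s) (phi s0); have := hB s s0 Is Is0 ns ns0.
  rewrite !ler_norml => /andP[_ h1] /andP[h2 _].
  have := mm_d_tri (psi s0) y (psi s).
  have := mm_d_tri (psi s) y (psi s0).
  rewrite (mm_d_sym y (psi s0)) (mm_d_sym y (psi s)) (mm_d_sym (psi s0) (psi s)).
  lra.
have Smem y s : I01 s -> ~ Bad s -> S y (f (phi s) + mm_d (psi s) y) by exists s.
have g_le y s : I01 s -> ~ Bad s -> g y <= f (phi s) + mm_d (psi s) y.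
  move=> Is ns; apply: ge_inf; last exact: Smem.
  by exists (f (phi s) - e - mm_d (psi s) y); exact: Slb.
have glip y y' : g y - g y' <= mm_d y y'.
  have [[s0 [Is0 ns0]]|nex] := pselect (exists s, I01 s /\ ~ Bad s); last first.
    have E z : S z = set0.
      by apply/seteqP; split => r // [s [Is ns _]]; apply: nex; exists s.
    by rewrite /g !E inf0 subrr; exact: (@cdist_ge0 Y).
  rewrite lerBlDr -lerBlDl; apply: lb_le_inf; first by eexists; exact: (Smem _ s0).
  move=> _ [s [Is ns ->]]; have := g_le y s Is ns.
  by have := mm_d_tri (psi s) y' y; rewrite (mm_d_sym y' y); lra.
have lg : lip1 g.
  by move=> y y'; rewrite ler_norml glip andbT lerNl opprB mm_d_sym glip.
exists g => //; apply: dKF_le => //; [exact: lip1_bmeas..|].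
apply: le_trans lB; apply: lam_le => //.
  by apply: mI_dist_gt; exact: lip1_bmeas.
move=> t It /=; apply: contraPP => nB; apply/negP; rewrite -leNgt ler_norml.
have := g_le (psi t) t It nB; rewrite mm_d_refl addr0.
have : f (phi t) - e <= g (psi t).
  apply: lb_le_inf; first by eexists; exact: (Smem _ t).
  by have := Slb (psi t) t It nB; rewrite mm_d_refl subr0.
lra.
Qed.

Lemma dconc_lt_box (X Y : mmspace) e : box X Y < e -> dconc X Y < e.
Proof.
move=> /box_lt_pnear[phi [psi [e' [np e'e]]]].
have [pphi ppsi _] := np.
apply: (@le_lt_trans _ _ (dH_KF (lip1_param phi) (lip1_param psi))).
  apply: inf_nneg_le; last by exists phi, psi.
  by move=> y [? [? [_ [_ ->]]]]; exact: dH_KF_ge0.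
(* McShane extension gives only [<= e'], while [dH_KF] asks for strict bounds; hence the
   midpoint. *)
apply: (@le_lt_trans _ _ ((e' + e) / 2)); last by lra.
apply: inf_nneg_le; first by move=> y [].
split; first by have := pnear_ge0 np; lra.
split => [_ [f lf ->]|_ [g lg ->]].
  have [g lg h] := pnear_lip1 np lf.
  by exists (g \o psi); [exists g|lra].
have [f lf h] := pnear_lip1 (pnear_sym np) lg.
by exists (f \o phi); [exists f|rewrite dKF_sym; lra].
Qed.

Lemma lip1_comp_dist (X Y : mmspace) (p : mm_car X -> mm_car Y) y :
  (forall x x', mm_d (p x) (p x') <= mm_d x x') -> lip1 (fun x => mm_d y (p x)).
Proof.
move=> lp x x'; have := lp x x'; have := mm_d_tri y (p x) (p x').
have := mm_d_tri y (p x') (p x); rewrite (mm_d_sym (p x') (p x)) ler_norml; lra.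
Qed.

(* The distances to finitely many points [s c], [c < N], embed most of [Y] almost
   isometrically into [R^N]; replacing them by nearby 1-Lipschitz functions on [Z]
   gives the image [W] of [Z]. *)
Lemma lip_le_approx (Y : mmspace) (e : RR) : 0 < e -> exists2 d, 0 < d &
  forall X Z, lip_le Y X -> dconc X Z < d -> exists2 W, lip_le W Z & box Y W < e.
Proof.
(* Distances will be off by at most [2 * r + 2 * d <= 4 * r], and the exceptional set has measure at
   most [2 * r]; so [e / 8] leads to [e / 2]. *)
move=> e0; pose r := e / 8; have r0 : 0 < r by rewrite /r; lra.
have [l [bl [s hs]]] := exists_label Y r0.
have [phi0 pphi0] := exists_parameter Y.
have [N hN] := lam_label_cover (mI_label (parameter_bmeas pphi0) bl) r0.
(* Each of the [N] functions has its own exceptional set of measure at most [d]; together they cost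
   at most [r]. *)
pose d := r / N.+1%:R.
have N0 : 0 < N.+1%:R :> RR by rewrite ltr0n.
have d0 : 0 < d by rewrite divr_gt0.
have N1 : 1 <= N.+1%:R :> RR by rewrite ler1n.
have dr : d <= r by rewrite /d ler_pdivrMr // ler_peMr // ltW.
have Nd : N%:R * d <= r.
  rewrite /d mulrCA ger_pMr // ler_pdivrMr // mul1r ler_nat; exact: leqnSn.
exists d => // X Z [p [lp mup]] /dconc_lt[phi [psi [pphi ppsi hfg]]].
have ex c : exists g, lip1 g /\ exists Bad, [/\ mI Bad, lam Bad <= d &
    forall t, I01 t -> ~ Bad t -> `|mm_d (s c) (p (phi t)) - g (psi t)| <= d].
  have lf := lip1_comp_dist (s c) lp.
  have [g lg /dKF_lt h] := hfg _ lf; exists g; split => //.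
  by apply: h; exact: lip1_bmeas.
have [g hg] := choice ex.
have lg c : lip1 (g c) by have [] := hg c.
have [Bad hB] := choice (fun c => (hg c).2).
have lG : @clip1 Z (vec N) (mkvec g N) by exact: mkvec_clip1.
have mG : bmeas (mkvec g N \o psi) by exact: (bmeas_clip1 lG (parameter_bmeas ppsi)).
exists (push mG); first exact: lip_le_push.
have ppphi := lip_le_parameter lp mup pphi.
have mlab := mI_label (parameter_bmeas ppphi) bl.
have mlt := mI_label_lt mlab N.
pose B n := \bigcup_(c in [set c | (c < n)%N]) Bad c.
have mBn n : mI (B n) by apply: mI_bigcup_count => c _; have [] := hB c.
have lBn n : lam (B n) <= n%:R * d.
  elim: n => [|n IHn].
    rewrite mul0r (_ : B 0%N = set0) ?lam0 //.
    by apply/seteqP; split => t // [c].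
  have -> : B n.+1 = B n `|` Bad n.
    apply/seteqP; split => t.
      move=> [c /=]; rewrite ltnS leq_eqVlt => /orP[/eqP->|cn]; first by right.
      by move=> Bt; left; exists c.
    by case=> [[c /= cn Bt]|Bt]; [exists c => //=; exact: ltnW|exists n => /=].
  have [mb lb _] := hB n.
  have := lamU_le (mBn n) mb; rewrite -natr1 mulrDl mul1r; lra.
suff np : pnear (p \o phi) (X := Y) (Y := push mG) (mkvec g N \o psi) (e / 2).
  by have := pnear_box np; lra.
split; [exact: ppphi|exact: (push_parameter mG)|].
exists (B N `|` ~` [set t | (l ((p \o phi) t) < N)%N]); split.
- by apply: mIU => //; exact: mIC.
- apply: le_trans (lamU_le (mBn N) (mIC mlt)) _; rewrite lamC // -(lam_label_sum mlab).
  have E c : lam [set t | l ((p \o phi) t) = c] = lam [set t | l (phi0 t) = c].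
    rewrite -(parameter_mur ppphi (bl c)).
    exact: (parameter_mur pphi0 (bl c)).
  rewrite (eq_bigr _ (fun c _ => E c)); have := lBn N.
  by move: hN Nd; rewrite /r; lra.
move=> a b Ia Ib /not_orP[na /contrapT la] /not_orP[nb /contrapT lb].
set D := mm_d _ _; set D' := mm_d _ _.
have D0 : 0 <= D by exact: (@cdist_ge0 Y).
have hc t c : I01 t -> ~ B N t -> (c < N)%N ->
    `|mm_d (s c) (p (phi t)) - g c (psi t)| <= d.
  by move=> It nB cN; have [_ _] := hB c; apply => // Bt; apply: nB; exists c.
have up : D' <= D + 2 * d.
  apply: mkvec_dist_le => [|c cN]; first by lra.
  have := hc a c Ia na cN; have := hc b c Ib nb cN.
  have := lip1_comp_dist (s c) lp (phi a) (phi b).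
  have := mm_d_tri (s c) (p (phi a)) (p (phi b)).
  have := mm_d_tri (s c) (p (phi b)) (p (phi a)).
  by rewrite (mm_d_sym (p (phi b))) -/D !ler_norml; lra.
(* One coordinate suffices: the centre [s c] of the cell of the first point is within [r] of it, so
   the distance to [s c] almost realises [D]. *)
have dn : D - 2 * r - 2 * d <= D'.
  apply: (le_trans _ (le_mkvec_dist g (psi a) (psi b) la)); set c := l _.
  have := hc a c Ia na la; have := hc b c Ib nb la.
  have h1 : mm_d (s c) (p (phi a)) < r by exact: (hs (p (phi a))).
  have := mm_d_tri (p (phi a)) (s c) (p (phi b)); rewrite -/D (mm_d_sym _ (s c)).
  move: h1; rewrite !ler_norml; set G := g c (psi b) => h1 h2 h3 h4.
  by rewrite ler_normr; apply/orP; right; lra.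
by move: dr; rewrite ler_norml /r in up dn *; lra.
Qed.

Lemma lip_le_refl X : lip_le X X.
Proof. by exists id. Qed.

(** The number [d] is the same for all pyramids; this uniformity is what allows the comparison along
    sequences and nets. *)
Lemma pyramid_dconc_box X (e : RR) : 0 < e -> exists2 d, 0 < d &
  forall P Y, pyramid P -> P Y -> dconc X Y < d -> exists2 W, P W & box X W < e.
Proof.
move=> e0; have [d d0 hd] := lip_le_approx X e0; exists d => // P Y [_ [_ [lowP _]]] PY XY.
have [W WY XW] := hd X Y (lip_le_refl X) XY; exists W => //.
exact: lowP WY.
Qed.

(** * Weak and Kuratowski-Painleve convergence *)

Lemma pyramid_conc_closed P : pyramid P -> conc_closed P.
Proof.
move=> pP X h; have [_ [clP _]] := pP; apply: clP => e e0.
have [d d0 hd] := pyramid_dconc_box X e0.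
by have [Y PY XY] := h d d0; exact: hd XY.
Qed.

Lemma weak_cvg_approx (Pn : nat -> set mmspace) A X (e : RR) :
  (forall n, pyramid (Pn n)) -> weak_cvg Pn A -> A X -> 0 < e ->
  exists N, forall n, (N <= n)%N -> exists2 Y, Pn n Y & box X Y < e.
Proof.
move=> pPn [cv _] AX e0; move/cvgrPdist_lt : (cv X AX) => /(_ e e0)[N _ hN].
exists N => n Nn; apply: (box_set_lt (pPn n).1); have := hN n Nn.
by rewrite /= sub0r normrN ger0_norm //; exact: box_set_ge0.
Qed.

Lemma weak_cvg_KP (Pn : nat -> set mmspace) P : (forall n, pyramid (Pn n)) ->
  weak_cvg Pn P -> KP_cvg (fun i j => (i <= j)%N) Pn P.
Proof.
move=> pPn cv; have [_ cv2] := cv.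
have sub1 : P `<=` Li_net (fun i j => (i <= j)%N) Pn.
  move=> X PX e e0; have [N hN] := weak_cvg_approx pPn cv PX e0.
  by exists N => n /hN[Y PY /dconc_lt_box ?]; exists Y.
have sub2 : Li_net (fun i j => (i <= j)%N) Pn `<=` Ls_net (fun i j => (i <= j)%N) Pn.
  move=> X h e e0 i; have [j hj] := h e e0.
  by exists (maxn i j); split; [exact: leq_maxl|exact: hj (leq_maxr _ _)].
have sub3 : Ls_net (fun i j => (i <= j)%N) Pn `<=` P.
  move=> X h; apply: contrapT => /cv2[e e0 [N hN]].
  have [d d0 hd] := pyramid_dconc_box X e0.
  have [n [Nn [Y PY XY]]] := h d d0 N.
  have [W PW XW] := hd _ _ (pPn n) PY XY.
  have := le_trans (hN n Nn) (box_set_le X PW); lra.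
split; apply/seteqP; split => //.
  exact: subset_trans sub3.
exact: subset_trans sub2.
Qed.

(** * Separability of the box distance *)

Lemma rat_below (x e : RR) : 0 <= x -> 0 < e ->
  exists q : rat, 0 <= (ratr q : RR) <= x /\ x - e <= ratr q.
Proof.
move=> x0 e0; have [xe|ex] := leP x e.
  by exists 0; rewrite raddf0 lexx x0; split => //; lra.
have [q] := @rat_in_itvoo RR (x - e) x ltac:(lra).
rewrite in_itv /= => /andP[h1 h2]; exists q; lra.
Qed.

Lemma rat_approx (x e : RR) : 0 < e -> exists q : rat, `|x - ratr q| <= e.
Proof.
move=> e0; have [q] := @rat_in_itvoo RR x (x + e) ltac:(lra).
by rewrite in_itv /= => /andP[h1 h2]; exists q; rewrite ler_norml; lra.
Qed.

(* [mesh (ms, dm, k)]: spaces with a Borel partition whose cells have at least the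
   masses listed in [ms] and approximately the mutual distances listed in [dm]. *)
Definition mesh (D : seq rat * seq (seq rat) * nat) (Y : mmspace) : Prop :=
  let: (ms, dm, k) := D in
  exists l : mm_car Y -> nat, [/\ forall c, borel [set y | l y = c],
    forall c, (c < size ms)%N -> 0 <= (ratr (nth 0 ms c) : RR) <= mur [set y | l y = c],
    1 - k.+1%:R^-1 <= \sum_(0 <= c < size ms) (ratr (nth 0 ms c) : RR) &
    forall x y, (l x < size ms)%N -> (l y < size ms)%N ->
      `|mm_d x y - ratr (nth 0 (nth [::] dm (l x)) (l y))| <= k.+1%:R^-1].

(** Since [relabel] needs only common lower bounds for the masses, rational data suffice. Matched
    points then have distances close to the same entry of the table [dm]. *)
Lemma mesh_box ms dm k Y Y' : mesh (ms, dm, k) Y -> mesh (ms, dm, k) Y' ->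
  box Y Y' <= 2 * k.+1%:R^-1.
Proof.
have e0 : 0 < k.+1%:R^-1 :> RR by rewrite invr_gt0 ltr0n.
rewrite /mesh; move: (k.+1%:R^-1) e0 => e e0.
move=> [l [bl hm hs hd]] [l' [bl' hm' hs' hd']].
have [phi pphi] := exists_parameter Y; have [phi' pphi'] := exists_parameter Y'.
have ma := mI_label (parameter_bmeas pphi) bl.
have mb := mI_label (parameter_bmeas pphi') bl'.
pose m c : RR := ratr (nth 0 ms c).
have m0 c : (c < size ms)%N -> 0 <= m c by move=> /hm /andP[].
have mla c : (c < size ms)%N -> m c <= lam [set t | l (phi t) = c].
  by move=> /hm /andP[_]; rewrite (parameter_mur pphi (bl c)).
have mlb c : (c < size ms)%N -> m c <= lam [set t | l' (phi' t) = c].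
  by move=> /hm' /andP[_]; rewrite (parameter_mur pphi' (bl' c)).
have [tau [tau' [Bad [mtau mtau' mB lB hB]]]] := relabel ma mb m0 mla mlb.
apply: (@pnear_box Y Y' (phi \o tau) (phi' \o tau')).
split; [exact: parameter_msp..|]; exists Bad; split => //.
  by move: lB hs; rewrite /m; lra.
move=> a b Ia Ib na nb; have [Ea la] := hB a Ia na; have [Eb lb] := hB b Ib nb.
have := hd _ _ la lb; rewrite /=.
have := hd' (phi' (tau' a)) (phi' (tau' b)); rewrite -Ea -Eb => /(_ la lb).
by rewrite !ler_norml; lra.
Qed.

Lemma mesh_exists X (e : RR) : 0 < e ->
  exists ms dm k, mesh (ms, dm, k) X /\ 2 * k.+1%:R^-1 < e.
Proof.
move=> e0; have [k hk] := exists_natSinv_lt (divr_gt0 e0 (ltr0n RR 2)).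
pose r : RR := k.+1%:R^-1; have r0 : 0 < r by rewrite /r invr_gt0 ltr0n.
(* Two centres and one rational approximation cost [r / 4] each in distance; the tail of the
   partition and the [N] mass roundings cost [r / 2] each. *)
have [l [bl [s hs]]] := exists_label X (divr_gt0 r0 (ltr0n RR 4)).
have [phi pphi] := exists_parameter X.
have [N hN] := lam_label_cover (mI_label (parameter_bmeas pphi) bl) (divr_gt0 r0 (ltr0n RR 2)).
pose d := r / 2 / N.+1%:R.
have N0 : 0 < N.+1%:R :> RR by rewrite ltr0n.
have d0 : 0 < d by rewrite /d !divr_gt0.
have Nd : N%:R * d <= r / 2.
  rewrite /d mulrCA ger_pMr ?divr_gt0 // ler_pdivrMr // mul1r ler_nat; exact: leqnSn.
have [q hq] := choice (fun c => rat_below (mur_ge0 (bl c)) d0).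
have [f hf] := choice (fun cc : nat * nat =>
  rat_approx (mm_d (s cc.1) (s cc.2)) (divr_gt0 r0 (ltr0n RR 4))).
exists (mkseq q N), (mkseq (fun c => mkseq (fun c' => f (c, c')) N) N), k.
split; last by move: hk; rewrite -/r; lra.
exists l; rewrite -/r size_mkseq; split.
- exact: bl.
- by move=> c cN; rewrite nth_mkseq //; have [] := hq c.
- rewrite (@eq_big_nat _ _ _ _ _ _ (fun c => ratr (q c))); last first.
    by move=> c /andP[_ cN]; rewrite nth_mkseq.
  have : \sum_(0 <= c < N) (mur [set x | l x = c] - d) <= \sum_(0 <= c < N) (ratr (q c) : RR).
    by apply: ler_sum => c _; have [] := hq c.
  rewrite big_split /= sumrN sumr_const_nat subn0 -mulr_natl.
  have E c : mur [set x | l x = c] = lam [set t | l (phi t) = c].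
    exact: (parameter_mur pphi (bl c)).
  rewrite (eq_bigr _ (fun c _ => E c)); move: hN Nd; lra.
- move=> x y xN yN; rewrite nth_mkseq // nth_mkseq //.
  have := hf (l x, l y); rewrite /= => h.
  have h1 : mm_d (s (l x)) x < r / 4 by exact: (hs x).
  have h2 : mm_d (s (l y)) y < r / 4 by exact: (hs y).
  have := mm_d_tri x (s (l x)) y; have := mm_d_tri (s (l x)) (s (l y)) y.
  have := mm_d_tri (s (l x)) x (s (l y)); have := mm_d_tri x y (s (l y)).
  rewrite (mm_d_sym x (s (l x))) (mm_d_sym y (s (l y))).
  by move: h; rewrite !ler_norml; lra.
Qed.

Definition pt_space : mmspace := push (@bmeas_cst unit_cms tt).

Lemma pt_space_le X : lip_le pt_space X.
Proof.
have [xi pxi] := exists_parameter X.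
exact: (@lip_le_push X unit_cms (fun=> tt) xi _ (fun x y => @cdist_ge0 X x y) pxi).
Qed.

(** Codes of meshes are countable; one space is picked for each realisable code, and any space is
    close to the pick for a fine mesh of its own. *)
Lemma box_separable : exists u : nat -> mmspace, forall X (e : RR), 0 < e ->
  exists n, box X (u n) < e.
Proof.
have ex D : exists Y, (exists Y', mesh D Y') -> mesh D Y.
  have [[Y hY]|nex] := pselect (exists Y', mesh D Y'); first by exists Y.
  by exists pt_space.
have [F hF] := choice ex.
exists (fun n => F (odflt ([::], [::], 0%N) (unpickle n))) => X e e0.
have [ms [dm [k [hX hk]]]] := mesh_exists X e0.
exists (pickle (ms, dm, k)); rewrite pickleK /=.
apply: le_lt_trans hk; apply: (mesh_box hX).
by apply: hF; exists X.
Qed.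

(** * From nets to sequences *)

Section directed_sets.
Variables (D : Type) (le : D -> D -> Prop).
Hypothesis dle : directed le.

(** For each [Q k] that holds residually an index [v k] is fixed beyond which it holds; [u n] is
    taken in [C] beyond [v 0], ..., [v n]. *)
Lemma directed_diag (Q : nat -> D -> Prop) (C : D -> Prop) :
  (forall i, exists j, le i j /\ C j) ->
  exists u : nat -> D, (forall n, C (u n)) /\
    forall k, (exists i, forall j, le i j -> Q k j) ->
      forall n, (k <= n)%N -> Q k (u n).
Proof.
move=> cof; have [[i0] refl trans dir] := dle.
have ex1 k : exists i, (exists i, forall j, le i j -> Q k j) -> forall j, le i j -> Q k j.
  have [[i hi]|nex] := pselect (exists i, forall j, le i j -> Q k j); first by exists i.
  by exists i0.
have [v hv] := choice ex1.
have ub n : exists i, forall k, (k <= n)%N -> le (v k) i.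
  elim: n => [|n [i hi]]; first by exists (v 0%N) => k; rewrite leqn0 => /eqP ->.
  have [j [ij vj]] := dir i (v n.+1); exists j => k.
  by rewrite leq_eqVlt => /orP[/eqP->//|/hi]; move/trans; apply.
have ex2 n : exists j, C j /\ forall k, (k <= n)%N -> le (v k) j.
  have [i hi] := ub n; have [j [ij Cj]] := cof i; exists j; split => // k /hi.
  by move/trans; apply.
have [u hu] := choice ex2.
exists u; split => [n|k hk n kn]; first by have [] := hu n.
by apply: hv => //; have [_] := hu n; apply.
Qed.

End directed_sets.

(** The events [hit] are countable in number and decide weak convergence: balls close around a point
    of [Li] are hit residually, small balls near a point outside [Ls] are missed residually. The
    diagonal sequence inherits both. *)
Lemma KP_weak_cvg (D : Type) (le : D -> D -> Prop) (A : D -> set mmspace)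
    (A0 : set mmspace) (C : D -> Prop) : directed le -> KP_cvg le A A0 ->
  (forall i, exists j, le i j /\ C j) -> (forall j, C j -> pyramid (A j)) ->
  exists u : nat -> D, (forall n, C (u n)) /\ weak_cvg (A \o u) A0.
Proof.
move=> dle [LiA LsA] cof pC; have [[i0] refl trans dir] := dle.
have [x hx] := box_separable.
pose e n : RR := n.+1%:R^-1.
have e0 n : 0 < e n by rewrite /e invr_gt0 ltr0n.
pose hit (k m : nat) j := exists2 W, A j W & box (x k) W < e m.
(* A hit is required only under [C j], because passing from [dconc] to [box] needs a pyramid; a miss
   follows from [dconc_lt_box] for any [A j]. *)
pose Q (n : nat) (j : D) : Prop :=
  let: (k, m, b) := odflt (0, 0, true)%N (unpickle n) in
  if b then C j -> hit k m j else ~ hit k m j.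
have [u [Cu hu]] := directed_diag dle Q cof.
have huQ (k m : nat) (b : bool) : (exists i, forall j, le i j -> Q (pickle (k, m, b)) j) ->
    exists N, forall n, (N <= n)%N -> Q (pickle (k, m, b)) (u n).
  by move=> h; exists (pickle (k, m, b)) => n; exact: hu.
exists u; split => //; split => X.
  rewrite -LiA => LiX; apply/cvgrPdist_lt => d d0.
  have [m hm] := exists_natSinv_lt (divr_gt0 d0 (ltr0n RR 2)).
  have em0 : 0 < e m / 2 by rewrite divr_gt0.
  have [k hk] := hx X _ em0.
  have [|N hN] := huQ k m true.
    have [d' d'0 hd'] := pyramid_dconc_box X em0.
    have [i hi] := LiX d' d'0; exists i => j ij; rewrite /Q pickleK /= => Cj.
    have [Y AY XY] := hi j ij; have [W AW XW] := hd' _ _ (pC j Cj) AY XY.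
    exists W => //; have := box_tri_lt (box_sym_lt hk) XW; lra.
  exists N => // n Nn; have := hN n Nn; rewrite /Q pickleK /= => /(_ (Cu n))[W AW xW].
  rewrite sub0r normrN ger0_norm; last exact: box_set_ge0.
  apply: le_lt_trans (box_set_le X AW) _.
  by have := box_tri_lt hk xW; move: hm; rewrite -/(e m); lra.
rewrite -LsA => /existsNP[d] /not_implyP[d0] /existsNP[i hi].
have [m hm] := exists_natSinv_lt (divr_gt0 d0 (ltr0n RR 2)).
have em0 : 0 < e m / 2 by rewrite divr_gt0.
have [k hk] := hx X _ em0.
have [|N hN] := huQ k m false.
  exists i => j ij; rewrite /Q pickleK /= => -[W AW xW]; apply: hi; exists j; split => //.
  exists W => //; apply: dconc_lt_box.
  by have := box_tri_lt hk xW; move: hm; rewrite -/(e m); lra.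
exists (e m / 2) => //; exists N => n Nn; have := hN n Nn; rewrite /Q pickleK /= => nhit.
rewrite leNgt; apply/negP => /(box_set_lt (pC _ (Cu n)).1)[W AW XW]; apply: nhit.
exists W => //; have := box_tri_lt (box_sym_lt hk) XW; lra.
Qed.

(** * Weak limits of pyramids *)

Section cluster.
Import ArrowAsProduct.

(** A cluster point, in the compact product of copies of [0, 1], of the filter of tails.
    Neighbourhoods there control finitely many coordinates at a time, so the index [i] depends on
    [ws]. *)
Lemma bounded_family_cluster (T : eqType) (q : nat -> T -> RR) :
  (forall i w, 0 <= q i w <= 1) ->
  exists p : T -> RR, forall (ws : seq T) (e : RR) N, 0 < e ->
    exists2 i, (N <= i)%N & forall w, w \in ws -> `|p w - q i w| < e.
Proof.
move=> hq.
pose F : set_system (forall w : T, (fun=> RR) w) :=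
  [set B | exists N, forall i, (N <= i)%N -> B (q i)].
have pF : ProperFilter F.
  apply: Build_ProperFilter_ex.
    by move=> B [N hN]; exists (q N); exact: hN.
  split.
  - by exists 0%N.
  - move=> B C [N hN] [M hM]; exists (maxn N M) => i; rewrite geq_max => /andP[a b].
    by split; [exact: hN|exact: hM].
  - by move=> B C BC [N hN]; exists N => i /hN/BC.
have := @tychonoff T (fun=> RR) (fun=> `[0, 1]%classic) (fun=> @segment_compact RR 0 1).
move=> /(_ F pF)[|p [_ cp]].
  by exists 0%N => i _ w /=; rewrite in_itv /=; exact: hq.
exists p => ws e N e0.
have nb : nbhs p [set f : forall w : T, (fun=> RR) w | forall w, w \in ws -> `|p w - f w| < e].
  elim: ws => [|w ws IHws]; first by apply: filterS filterT.
  have : nbhs p [set f : forall w : T, (fun=> RR) w | `|p w - f w| < e].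
    have := @proj_continuous T (fun=> RR) w p.
    move/cvgrPdist_lt => /(_ e e0); exact.
  move=> h; apply: filterS (filterI IHws h) => f [h1 h2] w'.
  by rewrite inE => /orP[/eqP->//|]; exact: h1.
have [|_ [[i Ni <-] hi]] := cp (q @` [set i | (N <= i)%N]) _ _ nb.
  by exists N => i Ni; exists i.
by exists i.
Qed.

End cluster.

Lemma mI_pickle (T : countType) (f : RR -> T) :
  (forall w, mI [set t | f t = w]) -> forall c, mI [set t | pickle (f t) = c].
Proof.
move=> mf c; case E : (pickle_inv c : option T) => [w|].
  apply: eq_mI (mf w) => t _ /=; split => [->|fc].
    by have := @pickle_invK T c; rewrite E.
  by move: E; rewrite -fc pickleK_inv => -[].
apply: eq_mI mI0 => t _; split => //= fc.
by move: E; rewrite -fc pickleK_inv.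
Qed.

Lemma lam_pickle (T : countType) (f : RR -> T) w :
  lam [set t | pickle (f t) = pickle w] = lam [set t | f t = w].
Proof. by apply: eq_lam => t _ /=; split => [/(pcan_inj pickleK)|->]. Qed.

Local Arguments tree_word : simpl never.
Local Arguments label_word : simpl never.

(** * Cluster points of tight sequences of laws *)

Section cluster_limit.
Variables (Z : cms) (L : nat -> ccar Z -> nat) (alpha : nat -> RR -> ccar Z).
Hypothesis malpha : forall i, bmeas (alpha i).
Hypothesis bL : forall k c, cborel [set x | L k x = c].
Hypothesis Lsmall : forall k x y, L k.+1 x = L k.+1 y -> cdist x y <= k.+1%:R^-1.
Hypothesis Ltight : forall k (e : RR), 0 < e -> exists K, forall i,
  1 - e < lam [set t | (L k (alpha i t) < K)%N].

Let q i w := lam [set t | cell L w (alpha i t)].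

Let mcell i w : mI [set t | cell L w (alpha i t)].
Proof. exact: (malpha i (cborel_cell bL w)). Qed.

Let q_sum i w n : \sum_(0 <= c < n) q i (c :: w) =
  lam [set t | cell L w (alpha i t) /\ (L (size w) (alpha i t) < n)%N].
Proof.
have := @mur_label_sum (push (malpha i)) (cell L w) (L (size w)) (cborel_cell bL w) (bL _) n.
rewrite -[RHS]/(lam _) => <-; apply: eq_bigr => c _.
by rewrite /q cell_cons.
Qed.

Let mlt i k n : mI [set t | (L k (alpha i t) < n)%N].
Proof. exact: (malpha i (@borel_label_lt (push (malpha i)) (L k) (bL k) n)). Qed.

Section cluster_tree.
Variable p : seq nat -> RR.
Hypothesis hp : forall (ws : seq (seq nat)) (e : RR) N, 0 < e ->
  exists2 i, (N <= i)%N & forall w, w \in ws -> `|p w - q i w| < e.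

(** The word [w] and its first [n] children share the error [e] equally, whence [e / n.+1%:R]. *)
Let sum_approx w n (e : RR) : 0 < e -> exists i, `|p w - q i w| < e / n.+1%:R /\
  `|\sum_(0 <= c < n) p (c :: w) - \sum_(0 <= c < n) q i (c :: w)| <= n%:R * (e / n.+1%:R).
Proof.
move=> e0; set d := e / _.
have d0 : 0 < d by rewrite divr_gt0 ?ltr0n.
have [i _ hi] := hp (w :: [seq c :: w | c <- iota 0 n]) 0 d0.
exists i; split; first by apply: hi; rewrite mem_head.
rewrite -sumrB; apply: le_trans (ler_norm_sum _ _ _) _.
apply: (@le_trans _ _ (\sum_(0 <= c < n) d)); last first.
  by rewrite sumr_const_nat subn0 mulr_natl.
apply: ler_sum_nat => c /andP[_ cn]; apply: ltW; apply: hi.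
by rewrite inE map_f ?orbT // mem_iota.
Qed.

Let Nd n (e : RR) : e / n.+1%:R + n%:R * (e / n.+1%:R) = e.
Proof.
by rewrite -{1}[e / n.+1%:R]mul1r -mulrDl addrC natr1 mulrCA mulfV ?mulr1 // pnatr_eq0.
Qed.

(** Finite inequalities pass to the cluster point. That no mass is lost among infinitely many
    children is where [Ltight], uniform in [i], enters. *)
Lemma cluster_tree_mass : tree_mass p.
Proof.
split.
- move=> w; rewrite leNgt; apply/negP => pw; have pw0 : 0 < - p w by lra.
  have [i _ /(_ w (mem_head _ _))] := hp [:: w] 0 pw0.
  by have := lam_ge0 [set t | cell L w (alpha i t)]; rewrite -/(q i w) ltr_norml; lra.
- apply/eqP; rewrite -subr_eq0 -normr_le0; apply/ler_addgt0Pr => e e0; rewrite add0r.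
  have [i _ /(_ _ (mem_head _ _))] := hp [:: [::]] 0 e0.
  by rewrite /q (_ : [set _ | _] = setT) ?lamT; [exact: ltW|exact/seteqP].
- move=> w n; apply/ler_addgt0Pr => e e0.
  have [i []] := sum_approx w n e0.
  have := Nd n e; move: (e / n.+1%:R) => d Ed.
  have : \sum_(0 <= c < n) q i (c :: w) <= q i w.
    rewrite q_sum; apply: lam_le; [exact: (mII (mcell i w) (mlt i _ n))|exact: mcell|].
    by move=> t _ [].
  by rewrite ltr_norml ler_norml; lra.
- move=> w e e0; have e20 : 0 < e / 2 by lra.
  have [K hK] := Ltight (size w) e20; exists K.
  have [i []] := sum_approx w K e20.
  have := Nd K (e / 2); move: (e / 2 / K.+1%:R) => d Ed.
  have h1 : q i w - e / 2 < \sum_(0 <= c < K) q i (c :: w).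
    rewrite q_sum; have := hK i; have mK := mlt i (size w) K.
    have mA := mII (mcell i w) mK.
    have := lamU_le mA (mIC mK); rewrite lamC //.
    have : lam [set t | cell L w (alpha i t)] <=
        lam ([set t | cell L w (alpha i t)] `&` [set t | (L (size w) (alpha i t) < K)%N]
        `|` ~` [set t | (L (size w) (alpha i t) < K)%N]).
      apply: lam_le; [exact: mcell|exact: mIU mA (mIC mK)|] => t _ ct.
      by have [h|h] := pselect (L (size w) (alpha i t) < K)%N; [left|right].
    by rewrite -/(q i w); lra.
  by rewrite ltr_norml ler_norml; lra.
Qed.

End cluster_tree.

(* Prokhorov's theorem in Skorokhod's form. *)
Lemma cluster_limit : exists phi : RR -> ccar Z, bmeas phi /\
  forall (e : RR) N, 0 < e -> exists i tau tau' Bad, [/\ (N <= i)%N, msp tau, msp tau',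
    mI Bad /\ lam Bad <= e & forall t, I01 t -> ~ Bad t ->
      cdist (alpha i (tau' t)) (phi (tau t)) <= e].
Proof.
have q01 i w : 0 <= q i w <= 1.
  by rewrite lam_ge0 lam_le1.
have [p hp] := bounded_family_cluster q01.
have tp := cluster_tree_mass hp.
have pcell (w : seq nat) : 0 < p w -> cell L w !=set0.
  move=> pw; have [i _ /(_ _ (mem_head _ _)) hi] := hp [:: w] _ 0%N pw.
  apply: contrapT => /set0P/negP/negPn/eqP E; move: hi.
  rewrite /q (_ : [set _ | _] = set0); last by rewrite E.
  by rewrite lam0 subr0 gtr0_norm // ltxx.
(* The cells need not be continuity sets, so [p w] may differ from the mass of [cell L w] under the
   law of [phi]; only the distance bound along addresses is used below. *)
have [phi [mphi phiP]] := tree_limit tp Lsmall pcell.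
exists phi; split => // e N e0; have [k ke] := exists_natSinv_lt e0.
have mword w : mI [set t | tree_word p k.+2 t = w].
  have [<-|sw] := eqVneq (size w) k.+2; first by have [] := lam_tree_word tp w.
  apply: eq_mI mI0 => t _; split => // wt.
  by rewrite -wt size_tree_word eqxx in sw.
have mlabel i w : mI [set t | label_word L k.+2 (alpha i t) = w].
  have [<-|sw] := eqVneq (size w) k.+2; first exact: mcell.
  apply: eq_mI mI0 => t _; split => // wt.
  by rewrite -wt size_label_word eqxx in sw.
have ma := mI_pickle mword.
have e20 : 0 < e / 2 by lra.
have [M hM] := lam_label_cover ma e20.
pose d := e / 2 / M.+1%:R; have d0 : 0 < d by rewrite divr_gt0 ?ltr0n.
have Md : M%:R * d <= e / 2.
  rewrite /d mulrCA ger_pMr // ler_pdivrMr ?ltr0n // mul1r ler_nat; exact: leqnSn.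
have [i Ni hi] := hp (pmap pickle_inv (iota 0 M)) _ N d0.
(* Lowering the first [M] masses by [d] makes them lower bounds on both sides and loses at most
   [e / 2]; the maximum with 0 keeps them nonnegative. *)
pose m c : RR := Num.max 0 (lam [set t | pickle (tree_word p k.+2 t) = c] - d).
have m0 c : (c < M)%N -> 0 <= m c by rewrite /m le_max lexx.
have mla c : (c < M)%N -> m c <= lam [set t | pickle (tree_word p k.+2 t) = c].
  by rewrite /m ge_max lam_ge0 /= lerBlDr lerDl ltW.
have mlb c : (c < M)%N ->
    m c <= lam [set t | pickle (label_word L k.+2 (alpha i t)) = c].
  move=> cM; rewrite /m ge_max lam_ge0 /=.
  case E : (pickle_inv c : option (seq nat)) => [w|]; last first.
    rewrite (@eq_lam _ set0) ?lam0; last first.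
      by move=> t _; split => //= wc; move: E; rewrite -wc pickleK_inv.
    by have := lam_ge0 [set t | pickle (label_word L k.+2 (alpha i t)) = c]; lra.
  have <- : pickle w = c by have := @pickle_invK (seq nat) c; rewrite E.
  rewrite !lam_pickle.
  have [sw|sw] := eqVneq (size w) k.+2; last first.
    rewrite (@eq_lam _ set0) ?lam0; last first.
      by move=> t _; split => //= wc; rewrite -wc size_tree_word eqxx in sw.
    by have := lam_ge0 [set t | label_word L k.+2 (alpha i t) = w]; lra.
  have : `|p w - q i w| < d.
    by apply: hi; rewrite mem_pmap -E map_f // mem_iota.
  have [_] := lam_tree_word tp w; rewrite sw => ->.
  by rewrite /q /cell /= sw ltr_norml; lra.
have [tau [tau' [Bad [mtau mtau' mB lB hB]]]] := relabel ma (mI_pickle (mlabel i)) m0 mla mlb.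
exists i, tau, tau', Bad; split => //; first split => //.
  have : \sum_(0 <= c < M) (lam [set t | pickle (tree_word p k.+2 t) = c] - d)
      <= \sum_(0 <= c < M) m c.
    by apply: ler_sum => c _; rewrite /m le_max lexx orbT.
  by rewrite big_split /= sumrN sumr_const_nat subn0 -mulr_natl; lra.
move=> t It nB; have [/(pcan_inj pickleK) E _] := hB t It nB.
by apply: le_trans (ltW ke); apply: phiP; [exact: mtau.1|].
Qed.

End cluster_limit.

(** Off [Bad], a point of [alpha] in the inner [e]-neighbourhood of [U] forces the nearby point of
    [beta] into [U]; this is the hypothesis of [eq_law]. *)
Lemma parameter_limit (Y : mmspace) (beta : RR -> mm_car Y) : @bmeas Y beta ->
  (forall e : RR, 0 < e -> exists (alpha : RR -> mm_car Y) tau tau' Bad,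
    [/\ is_parameter alpha, msp tau, msp tau', mI Bad /\ lam Bad <= e &
    forall t, I01 t -> ~ Bad t -> mm_d (alpha (tau' t)) (beta (tau t)) <= e]) ->
  is_parameter beta.
Proof.
move=> mbeta h; split => // B bB.
pose m1 : {measure set (bcar Y) -> \bar RR} := @mmu Y.
pose m2 : {measure set (bcar Y) -> \bar RR} := image_measure mbeta mIT.
have m1T : m1 setT = 1%E by rewrite /m1 /= mmuE ?mm_mu_prob //; exact: (@cborelT Y).
have m2T : m2 setT = 1%E.
  by rewrite /m2 /= /image_measure preimage_setT !setIT leb_I01.
have E : m1 B = m2 B.
  apply: eq_law => //; first by rewrite m1T m2T.
    by rewrite m1T ltry.
  move=> U e oU e0; have [alpha [tau [tau' [Bad [palpha mtau mtau' [mB lB] hB]]]]] := h e e0.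
  have bU : borel U by exact: (@cborel_open Y).
  have bUe : borel (inner_nbhd U e) by exact: (@cborel_open Y _ (@inner_nbhd_open Y U e)).
  have mU := mbeta _ bU; have mUe := parameter_bmeas palpha bUe.
  rewrite /m1 /m2 /= mmuE // (parameter_lam palpha bUe) /image_measure setTI lamE //.
  rewrite -EFinD lee_fin.
  have [k1 k2] := mtau'.2 _ mUe; have [l1 l2] := mtau.2 _ mU.
  rewrite -k2 -l2; apply: (@le_trans _ _ (lam (tau @^-1` (beta @^-1` U) `|` Bad))).
    apply: lam_le => //; first exact: mIU.
    move=> t It [r er hr]; have [Bt|nB] := pselect (Bad t); first by right.
    by left; apply: hr => /=; apply: le_lt_trans er; exact: hB.
  by apply: le_trans (lamU_le l1 mB) _; rewrite lerD2l.
by rewrite -mmuE // -[RHS]/(m1 B) E /m2 /= /image_measure setTI.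
Qed.

(** * Limits of couplings and of pyramids *)

Section coupling_limit.
Variables Y Y' : mmspace.
Variables (a : nat -> RR -> mm_car Y) (a' : nat -> RR -> mm_car Y').
Hypotheses (pa : forall i, is_parameter (a i)) (pa' : forall i, is_parameter (a' i)).

Lemma bmeas_coupling i : @bmeas (prod_cms Y Y') (fun t => (a i t, a' i t)).
Proof. by apply: bmeas_pair; exact: parameter_bmeas. Qed.

Let label_tail (X : mmspace) (l : mm_car X -> nat) (e : RR) :
  (forall c, borel [set x | l x = c]) -> 0 < e ->
  exists K, forall phi : RR -> mm_car X, is_parameter phi ->
    1 - e < lam [set t | (l (phi t) < K)%N].
Proof.
move=> bl e0; have [K hK] := mur_label_cvg (@cborelT X) bl e0.
exists K => phi pphi; move: hK; rewrite murT setTI.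
by rewrite (parameter_mur pphi (borel_label_lt bl K)).
Qed.

(** Tightness is automatic, as the marginal laws do not depend on [i]: finitely many labels in each
    factor carry most of the mass of every coupling. The marginals of the limit are then identified
    by [parameter_limit]. *)
Lemma coupling_limit : exists phi : RR -> ccar (prod_cms Y Y'),
  [/\ bmeas phi, is_parameter (X := Y) (fst \o phi), is_parameter (X := Y') (snd \o phi) &
  forall (e : RR) N, 0 < e -> exists i tau tau' Bad, [/\ (N <= i)%N, msp tau, msp tau',
    mI Bad /\ lam Bad <= e & forall t, I01 t -> ~ Bad t ->
      @cdist (prod_cms Y Y') (a i (tau' t), a' i (tau' t)) (phi (tau t)) <= e]].
Proof.
have [L1 [bL1 L1s]] := exists_labels Y; have [L2 [bL2 L2s]] := exists_labels Y'.
pose L k (z : ccar (prod_cms Y Y')) : nat :=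
  if k is k'.+1 then pickle (L1 k' z.1, L2 k' z.2) else 0%N.
have bL k c : @cborel (prod_cms Y Y') [set z | L k z = c].
  case: k => [|k] /=.
    case: c => [|c].
      rewrite (_ : [set _ | _] = setT); [exact: cborelT|exact/seteqP].
    by rewrite (_ : [set _ | _] = set0); [exact: cborel0|apply/seteqP; split => z].
  case E : (pickle_inv c : option (nat * nat)) => [[c1 c2]|].
    rewrite (_ : [set _ | _] = fst @^-1` [set y | L1 k y = c1] `&`
      snd @^-1` [set y | L2 k y = c2]).
      by apply: cborelI; [exact: (clip1_borel (@clip1_fst Y Y'))
        |exact: (clip1_borel (@clip1_snd Y Y'))].
    have Ec := @pickle_invK (nat * nat)%type c; rewrite E /= in Ec.
    apply/seteqP; split => z /=.
      by rewrite -Ec => /(pcan_inj pickleK)[-> ->].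
    by move=> [-> ->].
  rewrite (_ : [set _ | _] = set0); first exact: cborel0.
  by apply/seteqP; split => z //= zc; move: E; rewrite -zc pickleK_inv.
have Ls k (x y : ccar (prod_cms Y Y')) : L k.+1 x = L k.+1 y -> cdist x y <= k.+1%:R^-1.
  by move=> /(pcan_inj pickleK)[h1 h2]; rewrite prod_distE ge_max L1s // L2s.
have Lt k (e : RR) : 0 < e -> exists K, forall i,
    1 - e < lam [set t | (L k (a i t, a' i t) < K)%N].
  case: k => [|k] e0 /=.
    exists 1%N => i; rewrite (_ : [set _ | _] = setT) ?lamT; last exact/seteqP.
    lra.
  have e20 : 0 < e / 2 by lra.
  have [K1 h1] := label_tail (bL1 k) e20; have [K2 h2] := label_tail (bL2 k) e20.
  pose s := [seq pickle (c1, c2) | c1 <- iota 0 K1, c2 <- iota 0 K2].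
  (* One more than the largest code of a pair of retained labels. *)
  exists (\max_(x <- s) x).+1 => i.
  have m1 := mI_label_lt (mI_label (parameter_bmeas (pa i)) (bL1 k)) K1.
  have m2 := mI_label_lt (mI_label (parameter_bmeas (pa' i)) (bL2 k)) K2.
  have := h1 _ (pa i); have := h2 _ (pa' i).
  have := lamU_le (mIC m1) (mIC m2); rewrite !lamC // -setCI lamC; last exact: mII.
  set A := (X in lam X) => hA.
  set B := (X in _ -> _ -> _ < lam X).
  suff : lam A <= lam B by move: hA; rewrite /A; lra.
  apply: lam_le; first exact: mII.
    exact: (bmeas_coupling i (@borel_label_lt (push (bmeas_coupling i)) (L k.+1) (bL k.+1) _)).
  move=> t It [/= t1 t2]; rewrite /B /= ltnS.
  apply: (@leq_bigmax_seq _ s xpredT id) => //.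
  by apply/allpairsP; exists (L1 k (a i t), L2 k (a' i t)); rewrite !mem_iota.
have [phi [mphi hphi]] := cluster_limit bmeas_coupling bL Ls Lt.
have lim1 := bmeas_clip1 (@clip1_fst Y Y') mphi.
have lim2 := bmeas_clip1 (@clip1_snd Y Y') mphi.
exists phi; split => //.
- apply: parameter_limit => // e /(hphi e 0%N)[i [tau [tau' [Bad [_ mt mt' hB h]]]]].
  exists (a i), tau, tau', Bad; split => // t It nB.
  exact: le_trans (clip1_fst _ _) (h t It nB).
- apply: parameter_limit => // e /(hphi e 0%N)[i [tau [tau' [Bad [_ mt mt' hB h]]]]].
  exists (a' i), tau, tau', Bad; split => // t It nB.
  exact: le_trans (clip1_snd _ _) (h t It nB).
Qed.

End coupling_limit.

(** Both [Y] and [Y'] are aligned with one parameter of [X], and the second gluing is also applied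
    to the first alignment. The resulting coupling is close to the image of [X] in the product of
    [Y1] and [Y1'], which [X] dominates. *)
Lemma common_bound_coupling (Y Y' Y1 Y1' X : mmspace) (e : RR) :
  box Y Y1 < e / 2 -> box Y' Y1' < e / 2 -> lip_le Y1 X -> lip_le Y1' X ->
  exists (a : RR -> mm_car Y) (a' : RR -> mm_car Y'),
  [/\ is_parameter a, is_parameter a' &
    forall m : @bmeas (prod_cms Y Y') (fun t => (a t, a' t)),
    exists2 W, lip_le W X & box (push m) W < e].
Proof.
move=> /box_lt_pnear[phi [psi [e1 [n1 h1]]]] /box_lt_pnear[phi' [psi' [e2 [n2 h2]]]].
move=> [p [lp mup]] [p' [lp' mup']].
have [xi pxi] := exists_parameter X.
have d1 : 0 < (e / 2 - e1) / 2 by lra.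
have d2 : 0 < (e / 2 - e2) / 2 by lra.
have [tau [tau' [mt mt' n3]]] := pnear_glue n1 (lip_le_parameter lp mup pxi) d1.
have pxi' := parameter_msp pxi mt'.
have [sg [sg' [ms ms' n4]]] := pnear_glue n2 (lip_le_parameter lp' mup' pxi') d2.
have n5 := pnear_msp n3 ms'.
pose zeta := xi \o tau' \o sg'.
have pzeta : is_parameter zeta by exact: parameter_msp pxi' ms'.
exists (phi \o tau \o sg'), (phi' \o sg).
have [q1 _ [B1 [mB1 lB1 hB1]]] := n5; have [q2 _ [B2 [mB2 lB2 hB2]]] := n4.
split => // m.
have lP : @clip1 X (prod_cms Y1 Y1') (fun x => (p x, p' x)) by exact: clip1_pair.
have mW := bmeas_clip1 lP (parameter_bmeas pzeta).
exists (push mW); first exact: lip_le_push.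
suff np : pnear (X := push m) (Y := push mW)
    (fun t => ((phi \o tau \o sg') t, (phi' \o sg) t))
    ((fun x => (p x, p' x)) \o zeta) (e1 + (e / 2 - e1) / 2 + (e2 + (e / 2 - e2) / 2)).
  by have := pnear_box np; lra.
split; [exact: (push_parameter m)|exact: (push_parameter mW)|].
exists (B1 `|` B2); split; first exact: mIU.
  exact: le_trans (lamU_le mB1 mB2) (lerD lB1 lB2).
move=> s t Is It /not_orP[s1 s2] /not_orP[t1 t2].
have := hB1 s t Is It s1 t1; have := hB2 s t Is It s2 t2.
change (`|mm_d (phi' (sg s)) (phi' (sg t)) - mm_d (p' (zeta s)) (p' (zeta t))|
    <= e2 + (e / 2 - e2) / 2 ->
  `|mm_d (phi (tau (sg' s))) (phi (tau (sg' t))) - mm_d (p (zeta s)) (p (zeta t))|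
    <= e1 + (e / 2 - e1) / 2 ->
  `|Num.max (mm_d (phi (tau (sg' s))) (phi (tau (sg' t))))
            (mm_d (phi' (sg s)) (phi' (sg t))) -
    Num.max (mm_d (p (zeta s)) (p (zeta t))) (mm_d (p' (zeta s)) (p' (zeta t)))|
    <= e1 + (e / 2 - e1) / 2 + (e2 + (e / 2 - e2) / 2)).
have := pnear_ge0 n1; have := pnear_ge0 n2.
move: (mm_d (phi _) _) (mm_d (phi' _) _) (mm_d (p _) _) (mm_d (p' _) _) => x x' y y'.
rewrite !ler_norml; case: (leP x x') => ?; case: (leP y y') => ? *; lra.
Qed.

Lemma weak_limit_directed (Pn : nat -> set mmspace) A : (forall n, pyramid (Pn n)) ->
  weak_cvg Pn A -> forall Y Y', A Y -> A Y' ->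
  exists X, [/\ A X, lip_le Y X & lip_le Y' X].
Proof.
move=> pPn cv Y Y' AY AY'; have [_ cv2] := cv.
have ex (i : nat) : exists x : nat * (RR -> mm_car Y) * (RR -> mm_car Y'),
    let: (j, a, a') := x in [/\ (i <= j)%N, is_parameter a, is_parameter a' &
      forall m : @bmeas (prod_cms Y Y') (fun t => (a t, a' t)),
      exists2 W, Pn j W & box (push m) W < i.+1%:R^-1].
  have e0 : 0 < i.+1%:R^-1 / 2 :> RR by rewrite divr_gt0 // invr_gt0 ltr0n.
  have [N1 hN1] := weak_cvg_approx pPn cv AY e0.
  have [N2 hN2] := weak_cvg_approx pPn cv AY' e0.
  pose j := maxn i (maxn N1 N2).
  have [Y1 P1 b1] := hN1 j ltac:(by rewrite /j !leq_max leqnn !orbT).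
  have [Y1' P1' b1'] := hN2 j ltac:(by rewrite /j !leq_max leqnn !orbT).
  have [_ [_ [low dir]]] := pPn j.
  have [X [PX YX YX']] := dir _ _ P1 P1'.
  have [a [a' [pa pa' h]]] := common_bound_coupling b1 b1' YX YX'.
  exists (j, a, a'); split => //; first exact: leq_maxl.
  by move=> m; have [W WX bW] := h m; exists W => //; exact: low WX.
have [x hx] := choice ex.
pose J i := (x i).1.1; pose a i := (x i).1.2; pose a' i := (x i).2.
have {}hx i : [/\ (i <= J i)%N, is_parameter (a i), is_parameter (a' i) &
    forall m : @bmeas (prod_cms Y Y') (fun t => (a i t, a' i t)),
    exists2 W, Pn (J i) W & box (push m) W < i.+1%:R^-1].
  by have := hx i; rewrite /J /a /a'; case: (x i) => [[]].
have pa i : is_parameter (a i) by have [] := hx i.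
have pa' i : is_parameter (a' i) by have [] := hx i.
have [phi [mphi p1 p2 hphi]] := coupling_limit pa pa'.
exists (push mphi); split; last 2 first.
- by exists fst; split => [z z'|B bB]; [exact: (@clip1_fst Y Y')|exact: p1.2].
- by exists snd; split => [z z'|B bB]; [exact: (@clip1_snd Y Y')|exact: p2.2].
(* If the limit coupling were outside [A], its distance to [Pn n] would eventually be at least [d].
   One late index contradicts this: [3 * (d / 4)] for approaching the coupling and [d / 4] for its
   neighbour in the pyramid. *)
apply: contrapT => /cv2[d d0 [N hN]].
have d40 : 0 < d / 4 by lra.
have [k hk] := exists_natSinv_lt d40.
have [i [tau [tau' [Bad [Ni mt mt' [mB lB] hB]]]]] := hphi _ (maxn N k) d40.
move: Ni; rewrite geq_max => /andP[Ni ki].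
have mi := bmeas_coupling pa pa' i.
have [iJ _ _ /(_ mi)[W PW bW]] := hx i.
have np : pnear (X := push mphi) (Y := push mi)
    (phi \o tau) ((fun t => (a i t, a' i t)) \o tau') (2 * (d / 4)).
  split; [exact: (parameter_msp (push_parameter mphi))
    |exact: (parameter_msp (push_parameter mi))|].
  exists Bad; split => //; first by lra.
  move=> s t Is It ns nt.
  exact: (@cdist_quad (prod_cms Y Y') _ _ _ _ (d / 4) (hB s Is ns) (hB t It nt)).
have b1 : box (push mphi) (push mi) < 3 * (d / 4).
  by have := pnear_box np; lra.
have b2 : box (push mi) W < d / 4.
  by apply: lt_trans bW _; exact: le_lt_trans (natSinv_le ki) hk.
have := box_tri_lt b1 b2.
have := le_trans (hN _ (leq_trans Ni iJ)) (box_set_le (push mphi) PW); lra.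
Qed.

Lemma weak_limit_pyramid (Pn : nat -> set mmspace) A : (forall n, pyramid (Pn n)) ->
  weak_cvg Pn A -> pyramid A.
Proof.
move=> pPn cv; have [_ cv2] := cv.
split; last split; last split.
(* The one-point space lies below every space, hence in every pyramid. *)
- exists pt_space; apply: contrapT => /cv2[d d0 [N hN]].
  have [[X PX] [_ [low _]]] := pPn N.
  have := le_trans (hN N (leqnn N)) (box_set_le pt_space (low _ _ PX (pt_space_le X))).
  by rewrite box_refl; lra.
- move=> X hX; apply: contrapT => /cv2[d d0 [N hN]].
  have d20 : 0 < d / 2 by lra.
  have [Y AY XY] := hX _ d20; have [M hM] := weak_cvg_approx pPn cv AY d20.
  have [W PW YW] := hM (maxn N M) (leq_maxr _ _).
  have := le_trans (hN _ (leq_maxl N M)) (box_set_le X PW).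
  by have := box_tri_lt XY YW; lra.
- move=> X Y AX YX; apply: contrapT => /cv2[d d0 [N hN]].
  have [d' d'0 hd'] := lip_le_approx Y d0.
  have [M hM] := weak_cvg_approx pPn cv AX d'0.
  have [Z PZ /dconc_lt_box XZ] := hM (maxn N M) (leq_maxr _ _).
  have [W WZ YW] := hd' _ _ YX XZ.
  have [_ [_ [low _]]] := pPn (maxn N M).
  have := le_trans (hN _ (leq_maxl N M)) (box_set_le Y (low _ _ PZ WZ)); lra.
- exact: weak_limit_directed cv.
Qed.

(** The inclusion Pi -> (F(X, dconc), tau_K) is a topological embedding:
    it is well defined (pyramids are dconc-closed), injective (trivially,
    being an inclusion), continuous, and a homeomorphism onto its image
    with the subspace topology. *)
Theorem theorem8p9 :
  (forall P, pyramid P -> conc_closed P) /\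
  (forall V, tauK_open V -> weak_open (V `&` pyramid)) /\
  (forall U, weak_open U -> exists2 V, tauK_open V & U = V `&` pyramid).
Proof.
split; first exact: pyramid_conc_closed.
split=> [V [Vcl Vopen]|U [Upyr Uopen]].
  split=> [P []//|P [VP pP] Pn pPn cv].
  have dnat : directed (fun i j : nat => (i <= j)%N).
    split=> [|i|i j k|i j]; [exact: (inhabits 0%N)|exact: leqnn|exact: leq_trans|].
    by exists (maxn i j); rewrite leq_maxl leq_maxr.
  have [|N hN] := Vopen _ _ dnat Pn _ P VP (weak_cvg_KP pPn cv).
    by move=> n; exact: pyramid_conc_closed.
  by exists N => n /hN.
(* The largest family of closed sets whose trace on the pyramids is [U]: only the pyramids outside
   [U] are removed. *)
exists [set A | conc_closed A /\ ~ (pyramid A /\ ~ U A)].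
  split=> [A []//|D le dle A clA A0 [clA0 hA0] KP].
  apply: contrapT => nev.
  (* A net of closed sets that is not eventually in this family visits the pyramids outside [U]
     cofinally, which is all that the extraction requires. *)
  have cof i : exists j, le i j /\ (pyramid (A j) /\ ~ U (A j)).
    apply: contrapT => nex; apply: nev; exists i => j ij; split => //.
    by move=> h; apply: nex; exists j.
  have [u [Cu cv]] := KP_weak_cvg dle KP cof (fun j h => h.1).
  have pu n : pyramid ((A \o u) n) by exact: (Cu n).1.
  apply: hA0; split; first exact: weak_limit_pyramid cv.
  move=> UA0; have [N hN] := Uopen _ UA0 _ pu cv.
  exact: (Cu N).2 (hN N (leqnn N)).
apply/seteqP; split => [P UP|P [[_ nP] pP]].
  have pP := Upyr _ UP; split => //; split; first exact: pyramid_conc_closed.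
  by case.
by apply: contrapT => nU; apply: nP.
Qed.
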